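(* Let $S\subset\mathbb{T}^2$ be compact and suppose no non-zero positive RP-measure on $\mathbb{T}^2$ has support contained in $S$. Then $A_{\vec 0}(\mathbb{D}^2)|_{T(S)}=\{f|_{T(S)}: f\in A_{\vec 0}(\mathbb{D}^2)\}$ is dense in $C(T(S))$ with respect to the supremum norm.
   Context: $T:\mathbb{T}^2\to\mathbb{T}^2$, $T(z_1,z_2)=(z_1,\overline{z_2})$. RP-measures on $\mathbb{T}^2$: real Borel measures $\mu$ of bounded variation on $\mathbb{T}^2$ whose Poisson integral $P[d\mu](z)=\int_{\mathbb{T}^2}\prod_{j=1}^2\frac{1-|z_j|^2}{|\zeta_j-z_j|^2}\,d\mu(\zeta)$ is the real part of a holomorphic function on $\mathbb{D}^2$. $A(\mathbb{D}^2)$ is the bidisc algebra regarded as a subspace of $C(\mathbb{T}^2)$; $A_{\vec 0}(\mathbb{D}^2)=\{z_1z_2 f: f\in A(\mathbb{D}^2)\}$. *)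

(* Defs.v *)
From HB Require Import structures.
From mathcomp Require Import all_boot all_order all_algebra.
From mathcomp Require Import all_classical all_reals all_analysis.
From mathcomp Require Import complex.
Import Order.TTheory GRing.Theory Num.Theory.

Set Implicit Arguments.
Unset Strict Implicit.
Unset Printing Implicit Defensive.

Local Open Scope ring_scope.
Local Open Scope classical_set_scope.

(* The complex numbers over a real closed field R, equipped with their
   standard (norm) topology and their structure of normed module over
   themselves (so that [differentiable] below means complex (C-linear)
   Frechet differentiability, i.e. holomorphy). *)
Definition Cplx (R : rcfType) := R[i].
HB.instance Definition _ (R : rcfType) := Num.ClosedField.on (Cplx R).
HB.instance Definition _ (R : rcfType) :=
  PseudoPointedMetric.copy (Cplx R) (Cplx R)^o.
HB.instance Definition _ (R : rcfType) :=
  GRing.ComAlgebra.copy (Cplx R) (Cplx R)^o.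
HB.instance Definition _ (R : rcfType) := Vector.copy (Cplx R) (Cplx R)^o.
HB.instance Definition _ (R : rcfType) :=
  NormedModule.copy (Cplx R) (Cplx R)^o.

Definition C2 (R : rcfType) := (Cplx R * Cplx R)%type.

Definition C2B (R : rcfType) := g_sigma_algebraType (@open (C2 R)).

Definition torus2 (R : rcfType) : set (C2 R) :=
  [set z | `|z.1| = 1 /\ `|z.2| = 1].
Definition open_bidisc (R : rcfType) : set (C2 R) :=
  [set z | `|z.1| < 1 /\ `|z.2| < 1].
Definition closed_bidisc (R : rcfType) : set (C2 R) :=
  [set z | `|z.1| <= 1 /\ `|z.2| <= 1].

Definition Tflip (R : rcfType) (z : C2 R) : C2 R := (z.1, conjc z.2).

Definition holomorphic_on (R : rcfType) (D : set (C2 R)) (f : C2 R -> Cplx R) :=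
  forall z, D z -> differentiable f z.

Definition bidisc_algebra (R : rcfType) (f : C2 R -> Cplx R) :=
  {within @closed_bidisc R, continuous f} /\ holomorphic_on (@open_bidisc R) f.

Definition in_A0 (R : rcfType) (h : C2 R -> Cplx R) :=
  exists f, bidisc_algebra f /\ forall z, @torus2 R z -> h z = z.1 * z.2 * f z.

Definition cmod (R : rcfType) (z : Cplx R) : R :=
  Num.sqrt (complex.Re z ^+ 2 + complex.Im z ^+ 2).

Definition poisson_kernel (R : realType) (z zeta : C2 R) : R :=
  ((1 - cmod z.1 ^+ 2) / cmod (zeta.1 - z.1) ^+ 2) *
  ((1 - cmod z.2 ^+ 2) / cmod (zeta.2 - z.2) ^+ 2).

Definition poisson_integral (R : realType)
    (mu : {measure set (C2B R) -> \bar R}) (z : C2 R) : \bar R :=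
  (\int[mu]_(zeta in (@torus2 R : set (C2B R))) (poisson_kernel z zeta)%:E)%E.

Definition positive_RP_measure (R : realType)
    (mu : {measure set (C2B R) -> \bar R}) :=
  [/\ (mu setT < +oo)%E,
      mu (~` (@torus2 R : set (C2B R))) = 0%E &
      exists F : C2 R -> Cplx R, holomorphic_on (@open_bidisc R) F /\
        forall z, @open_bidisc R z -> poisson_integral mu z = (complex.Re (F z))%:E].

Definition support_within (R : realType)
    (mu : {measure set (C2B R) -> \bar R}) (S : set (C2 R)) :=
  forall x : C2 R, ~ S x ->
    exists U : set (C2 R), [/\ open U, U x & mu (U : set (C2B R)) = 0%E].

(* Main.v *)
Require Import Defs.
From HB Require Import structures.
From mathcomp Require Import all_boot all_order all_algebra.
From mathcomp Require Import all_classical all_reals all_analysis.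
From mathcomp Require finmap.
From mathcomp Require Import complex measurable_realfun ring lra.
Import Order.TTheory GRing.Theory Num.Theory numFieldNormedType.Exports.
Set Implicit Arguments.
Unset Strict Implicit.
Unset Printing Implicit Defensive.
Local Open Scope ring_scope.
Local Open Scope classical_set_scope.

(* If no f in A_0 satisfies Re f > 0 on K = T(S), Hahn-Banach applied to
   u |-> inf_(f in A_0) sup_S (u + Re f o T) gives a nonzero positive functional
   on functions on S killing Re f o T for all f in A_0.  Riesz represents it by
   a positive measure mu on S.  The Poisson kernel is a real part of a Cauchy
   kernel plus twice the real part of some f o T with f in A_0; integrating, the
   Poisson integral of mu is the real part of a holomorphic function, so mu is a
   nonzero positive RP-measure on S, which is excluded.

   Hence some f = z1 z2 g in A_0 has Re f > 0 on K.  The uniform closure B of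
   A(D^2) on K then contains 1/f by the geometric series, hence
   conj z1 = z2 g / f and conj z2 = z1 g / f, so B = C(K) by Stone-Weierstrass.
   Given phi in C(K), f times an element of A(D^2) close to phi / f is an element
   of A_0 close to phi. *)

(** * Hahn-Banach for sublinear functionals *)

(** The hypothesis speaks only of positive measures, whereas the usual duality proof of density
    produces a complex annihilating measure, about which nothing is known. So duality serves only to
    find a single f with positive real part on K, and the algebraic structure does the rest: A_0 is
    an ideal of A(D^2), and 1/f becomes available.

    The map T links the two sides through the frequencies (m, n) of Fourier series on the torus. A
    real measure has a pluriharmonic Poisson integral when its coefficients with m n < 0 vanish. For
    f in A_0 the frequencies of f o T are (m, -n) with m, n >= 1, so killing Re f o T removes
    exactly that obstruction. The factor z1 z2 leaves out the frequencies with m n = 0, which an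
    RP-measure may carry.

    Positivity of Re f gives more than an f without zeros: by compactness the values of f on K lie
    in a bounded part of a half-plane Re >= d > 0, and this is what makes 1/f a uniform limit of
    polynomials in f. *)

Section hahn_banach.
Context {R : realType} {V : lmodType R}.
Variable D : set V.
Hypothesis D0 : D 0.
Hypothesis DD : forall u v, D u -> D v -> D (u + v).
Hypothesis DZ : forall (a : R) u, D u -> D (a *: u).

(** Functions are total on [V], but only their values on the subspace [D] count. One inequality for
    homogeneity suffices: the other follows on scaling back by 1/t. *)
Definition sublinear_on (p : V -> R) :=
  (forall u v, D u -> D v -> p (u + v) <= p u + p v) /\
  (forall (t : R) u, 0 < t -> D u -> p (t *: u) <= t * p u).

Lemma sublinear_on0 p : sublinear_on p -> p 0 = 0.
Proof.
move=> [pD pZ]; have := pD _ _ D0 D0; rewrite addr0 => h1.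
have h2 : 0 < 2^-1 :> R by rewrite invr_gt0.
have := pZ _ _ h2 D0; rewrite scaler0.
lra.
Qed.

Lemma sublinear_onZ p (t : R) u : sublinear_on p -> 0 < t -> D u ->
  p (t *: u) = t * p u.
Proof.
move=> [pD pZ] t0 Du; apply/eqP; rewrite eq_le pZ//=.
have tV : 0 < t^-1 by rewrite invr_gt0.
have := pZ _ _ tV (DZ t Du); rewrite scalerA mulVf ?gt_eqF// scale1r.
by rewrite -(ler_pM2l t0) mulrA divff ?gt_eqF// mul1r.
Qed.

Lemma sublinear_on_geN p q u : sublinear_on q ->
  (forall u, D u -> q u <= p u) -> D u -> - p (- u) <= q u.
Proof.
move=> sq qp Du; have DNu : D (- u) by rewrite -scaleN1r; exact: DZ.
have := sq.1 _ _ Du DNu; rewrite subrr (sublinear_on0 sq).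
have := qp _ DNu; lra.
Qed.

(** For subadditivity, two members q and r of the chain, nearly optimal at u and at v, are both
    bounded below by the smaller of the two, which is itself subadditive. The infimum is finite
    because each member is at least - p (- u) at u. *)
Lemma inf_chain_sublinear_on (p : V -> R) (A : set (V -> R)) :
  A !=set0 ->
  (forall q, A q -> sublinear_on q /\ forall u, D u -> q u <= p u) ->
  (forall q r, A q -> A r ->
    (forall u, D u -> q u <= r u) \/ (forall u, D u -> r u <= q u)) ->
  let m u := inf [set q u | q in A] in
  sublinear_on m /\ forall q u, A q -> D u -> m u <= q u.
Proof.
move=> [q0 Aq0] Aq tot m.
have mle q u : A q -> D u -> m u <= q u.
  move=> Aq' Du; apply: ge_inf; last by exists q.
  exists (- p (- u)) => _ [r Ar <-].
  by apply: sublinear_on_geN => //; have [] := Aq _ Ar.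
have ne u : [set q u | q in A] !=set0 by exists (q0 u); exists q0.
have mge u y : (forall q, A q -> y <= q u) -> y <= m u.
  by move=> h; apply: lb_le_inf => // _ [q /h hq <-].
split=> //; split=> [u v Du Dv|t u t0 Du].
  rewrite -lerBlDr; apply: (mge) => q Aq'; rewrite lerBlDr -lerBlDl.
  apply: (mge) => r Ar; rewrite lerBlDl.
  have [qr|rq] := tot _ _ Aq' Ar.
    apply: (le_trans (mle q _ Aq' (DD Du Dv))).
    have [[+ _] _] := Aq _ Aq' => /(_ _ _ Du Dv) /le_trans; apply.
    by rewrite lerD2l; exact: qr.
  apply: (le_trans (mle r _ Ar (DD Du Dv))).
  have [[+ _] _] := Aq _ Ar => /(_ _ _ Du Dv) /le_trans; apply.
  by rewrite lerD2r; exact: rq.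
rewrite -ler_pdivrMl//; apply: (mge) => q Aq'; rewrite ler_pdivrMl//.
apply: (le_trans (mle q _ Aq' (DZ t Du))).
by have [[_ +] _] := Aq _ Aq'; exact.
Qed.

(* Perturbing q in the direction v: by minimality this infimum equals q, which
   gives superadditivity. *)
Lemma minimal_sublinear_on_ge q v : sublinear_on q ->
  (forall r, sublinear_on r -> (forall u, D u -> r u <= q u) ->
     forall u, D u -> q u <= r u) ->
  D v -> forall u, D u -> q u + q v <= q (u + v).
Proof.
move=> sq qmin Dv.
pose r u := inf [set q (u + t *: v) - t * q v | t in [set t : R | 0 <= t]].
have qZ (t : R) u : 0 <= t -> D u -> q (t *: u) = t * q u.
  rewrite le_eqVlt => /predU1P[<- _|t0 Du]; last by rewrite (sublinear_onZ sq).
  by rewrite scale0r mul0r sublinear_on0.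
have rle u t : D u -> 0 <= t -> r u <= q (u + t *: v) - t * q v.
  move=> Du t0; apply: ge_inf; last by exists t.
  exists (- q (- u)) => _ [s /= s0 <-].
  have DNu : D (- u) by rewrite -scaleN1r; exact: DZ.
  have := sq.1 _ _ DNu (DD Du (DZ s Dv)).
  by rewrite addKr qZ//; lra.
have rge u y : (forall t, 0 <= t -> y <= q (u + t *: v) - t * q v) -> y <= r u.
  move=> h; apply: lb_le_inf; first by exists (q (u + 0 *: v) - 0 * q v); exists 0 => /=.
  by move=> _ [t /h ht <-].
have sr : sublinear_on r.
  split=> [u w Du Dw|t u t0 Du].
    rewrite -lerBlDr; apply: (rge) => t t0; rewrite lerBlDr -lerBlDl.
    apply: (rge) => s s0; rewrite lerBlDl.
    apply: (le_trans (rle _ (t + s) (DD Du Dw) (addr_ge0 t0 s0))).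
    rewrite scalerDl addrACA.
    have := sq.1 _ _ (DD Du (DZ t Dv)) (DD Dw (DZ s Dv)); lra.
  rewrite -ler_pdivrMl//; apply: (rge) => s s0; rewrite ler_pdivrMl//.
  apply: (le_trans (rle _ (t * s) (DZ t Du) (mulr_ge0 (ltW t0) s0))).
  rewrite -scalerA -scalerDr (qZ t) ?(ltW t0)//; last by apply: DD => //; exact: DZ.
  by rewrite mulrBr mulrA.
have rq u : D u -> r u <= q u.
  move=> Du; have := rle _ 0 Du (lexx 0).
  by rewrite scale0r addr0 mul0r subr0.
move=> u Du; have := qmin r sr rq u Du; have := rle _ 1 Du ler01.
by rewrite scale1r mul1r; lra.
Qed.

(** Zorn's lemma is applied to the sublinear functions below [p] rather than to partially defined
    linear extensions. A minimal one is subadditive and superadditive, hence linear. *)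
Theorem hahn_banach_sublinear_on p : sublinear_on p ->
  exists L : V -> R, [/\ forall u v, D u -> D v -> L (u + v) = L u + L v,
    forall (a : R) u, D u -> L (a *: u) = a * L u &
    forall u, D u -> L u <= p u].
Proof.
move=> sp.
pose Q := {q : V -> R | sublinear_on q /\ forall u, D u -> q u <= p u}.
(* The order is reversed, so that the maximal element given by Zorn's lemma is pointwise minimal. *)
pose le (q r : Q) := `[< forall u, D u -> sval r u <= sval q u >].
have pQ : sublinear_on p /\ forall u, D u -> p u <= p u by split.
have [|r q s /asboolP qr /asboolP rs|A tot|[q [sq qp]] qmin] :=
    @ZL_preorder Q (exist _ p pQ) le.
- by move=> q; apply/asboolP.
- by apply/asboolP => u Du; exact: le_trans (rs _ Du) (qr _ Du).
- have [->|/set0P[q0 Aq0]] := eqVneq A set0; first by exists (exist _ p pQ).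
  have AQ (q : V -> R) : [set sval q | q in A] q ->
      sublinear_on q /\ forall u, D u -> q u <= p u.
    by move=> [r Ar <-]; exact: (svalP r).
  have [||sm mle] := @inf_chain_sublinear_on p [set sval q | q in A] _ AQ.
  + by exists (sval q0); exists q0.
  + move=> _ _ [q Aq <-] [r Ar <-].
    by have [/asboolP|/asboolP] := tot _ _ Aq Ar; [right|left].
  + have Aq0' : [set sval q | q in A] (sval q0) by exists q0.
    have mQ u : D u -> inf [set q u | q in [set sval q | q in A]] <= p u.
      by move=> Du; apply: (le_trans (mle _ _ Aq0' Du)); case: (svalP q0) => _; exact.
    exists (exist _ (fun u => inf [set q u | q in [set sval q | q in A]])
             (conj sm mQ) : Q) => r Ar; apply/asboolP => u Du /=.
    by apply: mle => //; exists r.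
- have {}qmin r : sublinear_on r -> (forall u, D u -> r u <= q u) ->
      forall u, D u -> q u <= r u.
    move=> sr rq u Du.
    have rp w : D w -> r w <= p w by move=> Dw; exact: le_trans (rq _ Dw) (qp _ Dw).
    have := qmin (exist _ r (conj sr rp)); rewrite /le /= => h.
    have /h/asboolP : `[< forall u, D u -> r u <= q u >] by apply/asboolP.
    exact.
  have qD u v : D u -> D v -> q (u + v) = q u + q v.
    move=> Du Dv; apply/eqP; rewrite eq_le sq.1//=.
    exact: (minimal_sublinear_on_ge sq qmin Dv Du).
  have q0 := sublinear_on0 sq.
  have qN u : D u -> q (- u) = - q u.
    move=> Du; have DNu : D (- u) by rewrite -scaleN1r; exact: DZ.
    have := qD _ _ Du DNu; rewrite subrr q0; lra.
  exists q; split => // a u Du; have [a0|a0|->] := ltgtP a 0.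
  + have -> : a *: u = - (- a *: u) by rewrite scaleNr opprK.
    rewrite qN; last exact: DZ.
    by rewrite (sublinear_onZ sq) ?oppr_gt0// mulNr opprK.
  + by rewrite (sublinear_onZ sq).
  + by rewrite scale0r mul0r.
Qed.
End hahn_banach.

(** * Riesz-Markov representation *)

Section layers.
Context {R : realType}.

(** Discrete layer-cake bound: the sum counts the levels j < N strictly below y. With [clip_sum_le],
    where y is cut into slices of height at most 1, it compares an integral with [L] up to an error
    of one layer. *)
Lemma layer_le (N : nat) (y : R) : y <= N%:R ->
  y <= \sum_(j < N) (j%:R < y)%R%:R.
Proof.
elim: N => [|N ih] yN; first by rewrite big_ord0.
rewrite big_ord_recr /=; case: (leP y N%:R) => [yN'|Ny].
  by rewrite addr0 ih.
rewrite (eq_bigr (fun=> 1)); last first.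
  move=> j _; have -> // : j%:R < y.
  by apply: lt_trans Ny; rewrite ltr_nat.
by rewrite sumr_const card_ord -natr1 in yN *.
Qed.

Lemma clip_sum_le (N : nat) (y : R) : 0 <= y ->
  \sum_(j < N) Num.min 1 (Num.max 0 (y - j%:R)) <= y.
Proof.
move=> y0; suff : \sum_(j < N) Num.min 1 (Num.max 0 (y - j%:R)) <= Num.min y N%:R.
  by move/le_trans; apply; rewrite ge_min lexx.
elim: N => [|N ih]; first by rewrite big_ord0 le_min y0 lexx.
rewrite big_ord_recr /=; apply: (le_trans (lerD ih (lexx _))).
rewrite -natr1 /Num.min /Num.max; do ![case: ifPn]; rewrite -?leNgt; lra.
Qed.

End layers.

(** * Borel measurability of functions continuous on a closed set *)

Section borel_measurable.
Context {R : realType} {X : ptopologicalType}.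
Local Notation Borel := (g_sigma_algebraType (@open X)).

Lemma open_borel (U : set X) : open U -> measurable (U : set Borel).
Proof. by move=> oU; exact: sub_sigma_algebra. Qed.

Lemma closed_borel (D : set X) : closed D -> measurable (D : set Borel).
Proof.
move=> cD; rewrite -[D]setCK; apply: measurableC; apply: open_borel.
by rewrite openC.
Qed.

Lemma within_continuous_borel (D : set X) (u : X -> R) : closed D ->
  {within D, continuous u} -> measurable_fun (D : set Borel) (u : Borel -> R).
Proof.
move=> cD /continuousP cu mD; apply: (measurability _ (RGenOInfty.measurableE R)).
  move=> _ [_ [a ->] <-].
  have /open_subspaceP[V oV VD] := cu _ (@interval_open R (BRight a) +oo%O isT isT).
  rewrite setIC -VD; apply: measurableI; [exact: open_borel|exact: closed_borel].
exact: closed_borel.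
Qed.

End borel_measurable.

(** * The representing measure, built from an outer measure of Daniell type *)

Section riesz_markov.
Context {R : realType} {X : ptopologicalType}.
Variables (S : set X) (L : (X -> R) -> R).

Hypothesis cptS : compact S.
Hypothesis clS : closed S.
Hypothesis LD : forall u v : X -> R,
  {within S, continuous u} -> {within S, continuous v} ->
  L (fun x => u x + v x) = L u + L v.
Hypothesis LZ : forall (a : R) (u : X -> R), {within S, continuous u} ->
  L (fun x => a * u x) = a * L u.
Hypothesis L_ge0 : forall u : X -> R, {within S, continuous u} ->
  (forall x, S x -> 0 <= u x) -> 0 <= L u.
Hypothesis cozero : forall U : set X, open U ->
  exists2 phi : X -> R, continuous phi &
    (forall x, 0 <= phi x) /\ U = [set x | 0 < phi x].

Local Notation C u := {within S, continuous u}.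

Let CD (u v : X -> R) : C u -> C v -> C (fun x => u x + v x).
Proof. by move=> cu cv x; apply: cvgD; [exact: cu|exact: cv]. Qed.

Let CM (u v : X -> R) : C u -> C v -> C (fun x => u x * v x).
Proof. by move=> cu cv x; apply: cvgM; [exact: cu|exact: cv]. Qed.

Let Ccst (a : R) : C (fun _ => a).
Proof. by move=> x; exact: cvg_cst. Qed.

Let CZ a (u : X -> R) : C u -> C (fun x => a * u x).
Proof. by move=> cu; exact: CM. Qed.

Let CB (u v : X -> R) : C u -> C v -> C (fun x => u x - v x).
Proof. by move=> cu cv x; apply: cvgB; [exact: cu|exact: cv]. Qed.

Let Cmin (u v : X -> R) : C u -> C v -> C (fun x => Num.min (u x) (v x)).
Proof. by move=> cu cv x; apply: continuous_min; [exact: cu|exact: cv]. Qed.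

Let Cmax (u v : X -> R) : C u -> C v -> C (fun x => Num.max (u x) (v x)).
Proof. by move=> cu cv x; apply: continuous_max; [exact: cu|exact: cv]. Qed.

Let LB (u v : X -> R) : C u -> C v -> L (fun x => u x - v x) = L u - L v.
Proof.
move=> cu cv; have := LD (CB cu cv) cv.
move/(canLR (addrK _)) => <-; congr (L _ - _).
by apply/funext => x; rewrite subrK.
Qed.

Let L_le (u v : X -> R) : C u -> C v -> (forall x, S x -> u x <= v x) -> L u <= L v.
Proof.
move=> cu cv uv; rewrite -subr_ge0 -LB//; apply: L_ge0; first exact: CB.
by move=> x /uv; rewrite subr_ge0.
Qed.

Let L0 : L (fun=> 0) = 0.
Proof.
rewrite -[RHS](mul0r (L (fun=> 0))) -LZ; last exact: Ccst.
by congr L; apply/funext => x; rewrite mul0r.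
Qed.

Let one_ge0 : 0 <= L (fun=> 1).
Proof. by apply: L_ge0 => //; exact: Ccst. Qed.

(* Covering by increasing sequences of functions instead of open sets makes
   countable subadditivity a diagonal argument. *)
Definition increasing_cover (f : nat -> X -> R) (A : set X) :=
  [/\ forall n, C (f n), forall n x, S x -> 0 <= f n x,
    forall n x, S x -> f n x <= f n.+1 x &
    forall x, S x -> A x -> forall e, 0 < e -> exists n, 1 - e < f n x].

Lemma increasing_cover_le f A n m x : increasing_cover f A -> S x ->
  (n <= m)%N -> f n x <= f m x.
Proof.
move=> [_ _ fi _] Sx; elim: m => [|m ih]; first by rewrite leqn0 => /eqP ->.
rewrite leq_eqVlt ltnS => /predU1P[->//|/ih /le_trans]; apply; exact: fi.
Qed.

Let cover_cst (v : X -> R) (B : set X) : C v -> (forall x, S x -> 0 <= v x) ->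
  (forall x, S x -> B x -> 1 <= v x) -> increasing_cover (fun=> v) B.
Proof.
move=> cv v0 v1; split => // x Sx Bx e e0; exists 0%N.
by apply: lt_le_trans (v1 x Sx Bx); rewrite ltrBlDr ltrDl.
Qed.

(** Upper bounds of the sequence L (f n) stand in for its limit, so convergence never has to be
    discussed. The infimum [riesz_outer] is the Daniell upper integral of the indicator of A. *)
Definition outer_values (A : set X) : set R :=
  [set c | exists2 f, increasing_cover f A & forall n, L (f n) <= c].

Definition riesz_outer (A : set X) : R := inf (outer_values A).

Let outer_values_ge0 A : lbound (outer_values A) 0.
Proof.
by move=> c [f [cf f0 _ _] /(_ 0%N)]; apply: le_trans; exact: (L_ge0 (cf _) (f0 _)).
Qed.

Let outer_values_neq0 A : outer_values A !=set0.
Proof. by exists (L (fun=> 1)), (fun _ _ => 1) => //; apply: cover_cst => //; exact: Ccst. Qed.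

Lemma riesz_outer_ge0 A : 0 <= riesz_outer A.
Proof. apply: lb_le_inf; [exact: outer_values_neq0|exact: outer_values_ge0]. Qed.

Lemma riesz_outer_le f A c : increasing_cover f A ->
  (forall n, L (f n) <= c) -> riesz_outer A <= c.
Proof.
move=> fA fc; apply: ge_inf; last by exists f.
by exists 0; exact: outer_values_ge0.
Qed.

Lemma riesz_outer_adherent A e : 0 < e ->
  exists2 f, increasing_cover f A & forall n, L (f n) <= riesz_outer A + e.
Proof.
move=> e0; have [|c [f fA fc] ce] := @inf_adherent _ (outer_values A) e e0.
  split; first exact: outer_values_neq0.
  by exists 0; exact: outer_values_ge0.
by exists f => // n; exact: le_trans (fc n) (ltW ce).
Qed.

Lemma riesz_outer_le_fun (v : X -> R) (B : set X) : C v ->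
  (forall x, S x -> 0 <= v x) -> (forall x, S x -> B x -> 1 <= v x) ->
  riesz_outer B <= L v.
Proof. by move=> cv v0 v1; apply: (riesz_outer_le (cover_cst cv v0 v1)). Qed.

Lemma riesz_outer_mono A B : A `<=` B -> riesz_outer A <= riesz_outer B.
Proof.
move=> AB; apply: lb_le_inf => // c [f [cf f0 fi fB] fc].
by apply: (@riesz_outer_le f) => //; split => // x Sx /AB; exact: fB.
Qed.

(** Only points of [S] have to be covered, so the zero function covers the complement. *)
Lemma riesz_outerC : riesz_outer (~` S) = 0.
Proof.
apply/eqP; rewrite eq_le riesz_outer_ge0 andbT -[leRHS]L0.
by apply: riesz_outer_le_fun => //; exact: Ccst.
Qed.

Lemma riesz_outer0 : riesz_outer set0 = 0.
Proof.
by apply/eqP; rewrite eq_le riesz_outer_ge0 andbT -riesz_outerC riesz_outer_mono.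
Qed.

(* Dini's argument. *)
Lemma increasing_coverT f e : increasing_cover f setT -> 0 < e ->
  exists n, forall x, S x -> 1 - e < f n x.
Proof.
move=> [cf f0 fi fT] e0.
have fi' := increasing_cover_le (And4 cf f0 fi fT).
have /compact_near_coveringP/near_covering_withinP ncS := cptS.
have [|n _ h] := ncS nat \oo (fun n x => S x -> 1 - e < f n x) _.
  move=> x Sx; have [n fn] := fT x Sx I e e0.
  have /(cvgr_gt (f n x))/(_ _ fn) : f n y @[y --> within S (nbhs x)] --> f n x.
    by rewrite nbhs_subspace_in//; exact: cf.
  rewrite near_withinE => h.
  exists ([set y | S y -> 1 - e < f n y], [set m | (n <= m)%N]).
    by split; [exact: h|exact: nbhs_infty_ge].
  move=> [y m] /= [yn nm] Sy _; exact: lt_le_trans (yn Sy) (fi' n m y Sy nm).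
by exists n => x Sx; exact: (h n (leqnn n) x Sx Sx).
Qed.

Lemma riesz_outerT : riesz_outer setT = L (fun=> 1).
Proof.
apply/eqP; rewrite eq_le; apply/andP; split.
  by apply: riesz_outer_le_fun => //; exact: Ccst.
apply: lb_le_inf => // c [f fT fc].
apply/ler_addgt0Pr => e e0.
(* Dini gives 1 - f n < d on all of [S], so L 1 - L (f n) <= d L 1 <= e. The added 1 keeps the
   denominator positive when L 1 = 0. *)
pose d := e / (1 + L (fun=> 1)).
have L1 : 0 < 1 + L (fun=> 1) by rewrite ltr_wpDr.
have d0 : 0 < d by rewrite divr_gt0.
have [n fn] := increasing_coverT fT d0.
have [cf _ _ _] := fT.
have : L (fun x => 1 - f n x) <= L (fun x => d * 1).
  apply: L_le => [||x /fn]; [|exact: Ccst|lra].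
  by apply: CB => //; exact: Ccst.
rewrite (LB (@Ccst 1) (cf n)) (LZ d (@Ccst 1)) => h.
have dL : d * L (fun=> 1) <= e.
  rewrite /d mulrAC ler_pdivrMr// ler_pM2l//; lra.
have := fc n; lra.
Qed.

Let Csum (f : nat -> X -> R) n : (forall i, C (f i)) ->
  C (fun x => \sum_(i < n) f i x).
Proof.
move=> cf; elim: n => [|n ih].
  by under eq_fun do rewrite big_ord0; exact: Ccst.
by under eq_fun do rewrite big_ord_recr /=; exact: CD.
Qed.

Let Lsum (f : nat -> X -> R) n : (forall i, C (f i)) ->
  L (fun x => \sum_(i < n) f i x) = \sum_(i < n) L (f i).
Proof.
move=> cf; elim: n => [|n ih].
  by rewrite big_ord0 -[RHS]L0; congr L; apply/funext => x; rewrite big_ord0.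
rewrite big_ord_recr /= -ih -LD//; last exact: Csum.
by congr L; apply/funext => x; rewrite big_ord_recr.
Qed.

Let sum_half n (e : R) : \sum_(i < n) e / 2 ^+ i.+1 = e - e / 2 ^+ n.
Proof.
elim: n => [|n ih]; first by rewrite big_ord0 expr0 divr1 subrr.
by rewrite big_ord_recr /= ih exprS; field; rewrite expf_neq0.
Qed.

Lemma riesz_outer_sigma_subadditive :
  sigma_subadditive (fun A => (riesz_outer A)%:E).
Proof.
move=> F; apply/lee_addgt0Pr => e e0.
have e2 i : 0 < e / 2 ^+ i.+1 by rewrite divr_gt0// exprn_gt0.
have /choice[f fP] i : exists f, increasing_cover f (F i) /\
    forall n, L (f n) <= riesz_outer (F i) + e / 2 ^+ i.+1.
  by have [f ? ?] := riesz_outer_adherent (F i) (e2 i); exists f.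
have cf i n : C (f i n) by have [[+ _ _ _] _] := fP i; exact.
have f0 i n x : S x -> 0 <= f i n x by have [[_ + _ _] _] := fP i; exact.
have fi i n x : S x -> f i n x <= f i n.+1 x by have [[_ _ + _] _] := fP i; exact.
(* Diagonal sum: stage n uses the first n + 1 covers, each at its own stage n. Where the i-th cover
   exceeds 1 - d from stage n on, g does so at stage max (i, n). *)
pose g n x := \sum_(i < n.+1) f i n x.
have gF : increasing_cover g (\bigcup_n F n).
  split => [n|n x Sx|n x Sx|x Sx [i _ Fix] d d0].
  - exact: (@Csum (fun i => f i n) n.+1 (fun i => cf i n)).
  - by apply: sumr_ge0 => i _; exact: f0.
  - rewrite /g [leRHS]big_ord_recr /=; rewrite -[leLHS]addr0; apply: lerD; last exact: f0.
    by apply: ler_sum => i _; exact: fi.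
  - have [fF _] := fP i; have [_ _ _ /(_ x Sx Fix d d0)[n fn]] := fF.
    exists (maxn i n); apply: (lt_le_trans fn).
    apply: (le_trans (increasing_cover_le fF Sx (leq_maxr i n))).
    have ii : (i < (maxn i n).+1)%N by rewrite ltnS leq_maxl.
    rewrite /g (bigD1 (Ordinal ii))//= lerDl; apply: sumr_ge0 => j _; exact: f0.
case: (leP +oo%E (\sum_(i <oo) (riesz_outer (F i))%:E)%E) => [|oo].
  by rewrite leye_eq => /eqP ->; rewrite addye// leey.
have F0 i : (0 <= (riesz_outer (F i))%:E)%E by rewrite lee_fin riesz_outer_ge0.
have sfin : (\sum_(i <oo) (riesz_outer (F i))%:E)%E \is a fin_num.
  by rewrite ge0_fin_numE//; exact: nneseries_ge0.
rewrite -(fineK sfin) -EFinD lee_fin; apply: (riesz_outer_le gF) => n.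
rewrite /g (@Lsum (fun i => f i n) n.+1 (fun i => cf i n)).
apply: (@le_trans _ _ (\sum_(i < n.+1) (riesz_outer (F i) + e / 2 ^+ i.+1))).
  by apply: ler_sum => i _; case: (fP i) => _; exact.
rewrite big_split /= sum_half; apply: lerD.
  rewrite -lee_fin fineK// -sumEFin -(big_mkord xpredT (fun i => (riesz_outer (F i))%:E)).
  exact: nneseries_lim_ge.
by rewrite gerBl divr_ge0// ?ltW// exprn_gt0.
Qed.

(* With h_n = min(1, n phi) increasing to the indicator of {phi > 0}, a cover
   f_n of A splits into f_n h_n and f_n (1 - h_k) with k fixed. *)
Lemma riesz_outer_cozero (phi : X -> R) A : continuous phi ->
  (forall x, 0 <= phi x) ->
  riesz_outer (A `&` [set x | 0 < phi x]) +
  riesz_outer (A `&` ~` [set x | 0 < phi x]) <= riesz_outer A.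
Proof.
move=> cphi phi0; apply: lb_le_inf; first exact: outer_values_neq0.
move=> c [f fA fc]; have [cf f0 fi fA1] := fA.
pose h (n : nat) x := Num.min 1 (n%:R * phi x).
have ch n : C (h n).
  apply: Cmin; first exact: Ccst.
  by apply: CZ; apply: continuous_subspaceT.
have h0 n x : 0 <= h n x by rewrite le_min ler01 mulr_ge0.
have h1 n x : h n x <= 1 by rewrite ge_min lexx.
have hi n x : h n x <= h n.+1 x.
  by rewrite /h le_min !ge_min lexx /= ler_wpM2r ?orbT// ler_nat.
pose s := sup (range (fun n => L (fun x => f n x * h n x))).
have Lfh n : L (fun x => f n x * h n x) <= c.
  apply: le_trans (fc n); apply: L_le => // [|x Sx]; first exact: CM.
  by rewrite ler_piMr// f0.
have hs : has_sup (range (fun n => L (fun x => f n x * h n x))).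
  split; first by exists (L (fun x => f 0%N x * h 0%N x)), 0%N.
  by exists c => _ [n _ <-].
have mA1 : riesz_outer (A `&` [set x | 0 < phi x]) <= s.
  apply: (@riesz_outer_le (fun n x => f n x * h n x)); last first.
    by move=> n; apply: sup_ubound; [exact: hs.2|exists n].
  split => [n|n x Sx|n x Sx|x Sx [Ax phix] e e0]; first exact: CM.
  - by rewrite mulr_ge0// f0.
  - by apply: ler_pM => //; [exact: f0|exact: fi].
  - have [n fn] := fA1 x Sx Ax e e0.
    have [k hk] : exists k, h k x = 1.
      (* An integer k above 1 / phi x makes k phi x at least 1, so the truncation is attained. *)
      exists (Num.truncn (phi x)^-1).+1; apply/min_idPl.
      by rewrite -ler_pdivrMr// mul1r ltW// truncnS_gt.
    exists (maxn k n).
    have -> : h (maxn k n) x = 1.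
      apply/eqP; rewrite eq_le h1 andTb -{1}hk; move: (leq_maxl k n).
      elim: (maxn k n) => [|m ih]; first by rewrite leqn0 => /eqP ->; exact: lexx.
      rewrite leq_eqVlt ltnS => /predU1P[->//|/ih /le_trans]; apply; exact: hi.
    rewrite mulr1; apply: (lt_le_trans fn).
    exact: (increasing_cover_le fA Sx (leq_maxr k n)).
rewrite -lerBrDl; apply: (@le_trans _ _ (c - s)); last by rewrite lerD2l lerN2.
apply/ler_addgt0Pr => e e0.
(* Fix k with L (f_k h_k) > s - e. For m >= k, L (f_m (1 - h_k)) = L f_m - L (f_m h_k) <= c - L (f_k
   h_k) < c - s + e, which bounds the cover of the part outside {phi > 0}. *)
have [y [k _ yk] sk] := sup_adherent e0 hs; rewrite -{}yk in sk.
apply: (@riesz_outer_le (fun n x => f n x * (1 - h k x))); last first.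
  move=> n; apply: (@le_trans _ _ (L (fun x => f (maxn k n) x * (1 - h k x)))).
    apply: L_le => [||x Sx].
    - by apply: CM => //; apply: CB => //; exact: Ccst.
    - by apply: CM => //; apply: CB => //; exact: Ccst.
    - rewrite ler_wpM2r ?subr_ge0//.
      exact: (increasing_cover_le fA Sx (leq_maxr k n)).
  have -> : (fun x => f (maxn k n) x * (1 - h k x)) =
      (fun x => f (maxn k n) x - f (maxn k n) x * h k x).
    by apply/funext => x; rewrite mulrBr mulr1.
  rewrite LB//; last exact: CM.
  have : L (fun x => f k x * h k x) <= L (fun x => f (maxn k n) x * h k x).
    apply: L_le => [||x Sx]; [exact: CM|exact: CM|].
    by rewrite ler_wpM2r// (increasing_cover_le fA Sx (leq_maxl k n)).
  have := fc (maxn k n); rewrite -/s in sk *; lra.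
split => [n|n x Sx|n x Sx|x Sx [Ax phix] d d0].
- by apply: CM => //; apply: CB => //; exact: Ccst.
- by rewrite mulr_ge0 ?f0// subr_ge0.
- by rewrite ler_wpM2r ?fi// subr_ge0.
- have -> : h k x = 0.
    rewrite /h; have -> : phi x = 0 by apply/eqP; rewrite eq_le phi0 andbT leNgt; exact/negP.
    by rewrite mulr0; apply/min_idPr.
  by have [n fn] := fA1 x Sx Ax d d0; exists n; rewrite subr0 mulr1.
Qed.

Definition riesz_outer_measure : {outer_measure set X -> \bar R} :=
  HB.pack (fun A => (riesz_outer A)%:E) (isOuterMeasure.Build R X
    (fun A => (riesz_outer A)%:E) (congr1 EFin riesz_outer0)
    (fun A => riesz_outer_ge0 A) (fun A B AB => riesz_outer_mono AB)
    riesz_outer_sigma_subadditive).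

Local Notation Borel := (g_sigma_algebraType (@open X)).

(** Carathéodory-measurable sets form a sigma-algebra. It contains the cozero sets by
    [riesz_outer_cozero], and every open set is one of these. *)
Lemma borel_caratheodory (A : set Borel) :
  measurable A -> riesz_outer_measure.-caratheodory A.
Proof.
move=> mA.
have mO : @open X `<=` riesz_outer_measure.-cara.-measurable.
  move=> U /cozero[phi cphi [phi0 ->]].
  apply: le_caratheodory_measurable => B.
  by rewrite -EFinD lee_fin; exact: riesz_outer_cozero.
apply: (smallest_sub _ mO mA); exact: sigma_algebra_measurable.
Qed.

Lemma riesz_semi_sigma_additive :
  semi_sigma_additive (fun A : set Borel => (riesz_outer A)%:E).
Proof.
move=> F mF tF mUF.
apply: (@caratheodory_measure_sigma_additive _ _ riesz_outer_measure) => //.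
  by move=> i; exact: borel_caratheodory.
exact: borel_caratheodory.
Qed.

Definition riesz_measure : {measure set Borel -> \bar R} :=
  HB.pack (fun A : set Borel => (riesz_outer A)%:E) (isMeasure.Build _ Borel R
    (fun A : set Borel => (riesz_outer A)%:E) (congr1 EFin riesz_outer0)
    (fun A => riesz_outer_ge0 A) riesz_semi_sigma_additive).

Let mS : measurable (S : set Borel).
Proof. exact: closed_borel. Qed.

(** The integral is at most the sum of the measures of the sets {u > j}. On {u > j} the continuous
    slice min (1, max (0, u - (j - 1))) equals 1, so its image under [L] dominates that measure.
    Starting each slice one level lower costs the extra L 1. *)
Let integral_riesz_le1 (u : X -> R) (N : nat) : C u ->
  (forall x, S x -> 0 <= u x <= N%:R) ->
  (\int[riesz_measure]_(x in (S : set Borel)) (u x)%:E <= (L u + L (fun=> 1))%:E)%E.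
Proof.
move=> cu u0N; have mu := within_continuous_borel clS cu.
pose B j : set Borel := S `&` [set x | j%:R < u x].
have mB j : measurable (B j).
  have := mu mS `]j%:R, +oo[ (measurable_itv _).
  rewrite (_ : _ `&` _ = B j)//; apply/seteqP; split => x /=;
    by rewrite /B /= in_itv/= andbT.
have Ble j : (riesz_measure (B j) <=
   (L (fun x => Num.min 1 (Num.max 0 (u x - (j%:R - 1)))))%:E)%E.
  rewrite lee_fin; apply: riesz_outer_le_fun.
  - apply: Cmin; first exact: Ccst.
    by apply: Cmax; [exact: Ccst|apply: CB => //; exact: Ccst].
  - by move=> x Sx; rewrite le_min ler01 le_max lexx.
  - by move=> x Sx [_ /= jx]; rewrite le_min lexx le_max; apply/orP; right; lra.
apply: (@le_trans _ _ (\int[riesz_measure]_(x in (S : set Borel))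
    \sum_(j < N) (\1_(B j) x)%:E)%E).
  apply: ge0_le_integral => //.
  - by move=> x /u0N/andP[+ _]; rewrite lee_fin.
  - exact/measurable_EFinP.
  - apply: emeasurable_sum => j; apply/measurable_EFinP.
    exact: measurable_indic.
  - move=> x Sx; rewrite sumEFin lee_fin.
    have /andP[_ /layer_le] := u0N x Sx; move=> /le_trans; apply.
    apply: ler_sum => j _; rewrite indicE.
    by have [jx|//] := ltP j%:R (u x); rewrite mem_set.
rewrite ge0_integral_sum//; last first.
  by move=> j; apply/measurable_EFinP; exact: measurable_indic.
rewrite (eq_bigr (fun j : 'I_N => riesz_measure (B j))); last first.
  by move=> j _; rewrite integral_indic// setIidl// => x [].
apply: (@le_trans _ _ (\sum_(j < N)
   (L (fun x => Num.min 1 (Num.max 0 (u x - (j%:R - 1)))))%:E)%E).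
  by apply: lee_sum => j _; exact: Ble.
pose w j x := Num.min 1 (Num.max 0 (u x - (j%:R - 1))).
have cw j : C (w j).
  apply: Cmin; first exact: Ccst.
  by apply: Cmax; [exact: Ccst|apply: CB => //; exact: Ccst].
rewrite sumEFin lee_fin -(@Lsum w N cw) -(LD cu (@Ccst 1)).
apply: L_le => [||x /u0N/andP[u0 _]].
- exact: (@Csum w N cw).
- by apply: CD => //; exact: Ccst.
(* The slice of index 0 is at most 1; after a shift of index the others are the genuine slices of u
   and add up to at most u. *)
- case: N {u0N} => [|n]; first by rewrite big_ord0 addr_ge0.
  rewrite big_ord_recl addrC lerD//; last by rewrite ge_min lexx.
  apply: le_trans (clip_sum_le n u0); apply: ler_sum => j _.
  by rewrite /w lift0 -natr1 addrK.
Qed.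

(** The error L 1 of the crude bound does not depend on u. Applied to k u and divided by k, the
    bound has error L 1 / k, which is below any e. *)
Lemma integral_riesz_le (u : X -> R) (M : R) : C u ->
  (forall x, S x -> 0 <= u x <= M) ->
  (\int[riesz_measure]_(x in (S : set Borel)) (u x)%:E <= (L u)%:E)%E.
Proof.
move=> cu u0M; have mu := within_continuous_borel clS cu.
apply/lee_addgt0Pr => e e0.
pose k := (Num.truncn (L (fun=> 1) / e)).+1.
have k0 : 0 < k%:R :> R by rewrite ltr0n.
have ke : L (fun=> 1) / k%:R <= e.
  by rewrite ler_pdivrMr// mulrC -ler_pdivrMr// ltW// truncnS_gt.
pose N := (Num.truncn (k%:R * M)).+1.
have := @integral_riesz_le1 (fun x => k%:R * u x) N (CZ cu).
under eq_integral do rewrite EFinM.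
have mEu : measurable_fun (S : set Borel) (fun x : Borel => (u x)%:E).
  exact/measurable_EFinP.
have u0 (x : Borel) : S x -> (0 <= (u x)%:E)%E.
  by move=> /u0M/andP[+ _]; rewrite lee_fin.
rewrite ge0_integralZl// LZ// => h.
have {}h : (k%:R%:E * \int[riesz_measure]_(x in (S : set Borel)) (u x)%:E <=
    k%:R%:E * (L u + e)%:E)%E.
  apply: le_trans (h _) _ => [x Sx|].
    have /andP[ux0 uM] := u0M x Sx.
    rewrite mulr_ge0//= ltW// (le_lt_trans _ (truncnS_gt _))// ler_wpM2l//.
  rewrite -EFinM lee_fin mulrDr lerD2l.
  by rewrite mulrC -ler_pdivrMr.
by move: h; rewrite lee_pmul2l// lte_fin.
Qed.

(** The reverse inequality is the previous bound for M - u, since the measure of [S] is exactly L 1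
    and both sides are therefore equal on constants. *)
Theorem integral_riesz (u : X -> R) (M : R) : C u ->
  (forall x, S x -> 0 <= u x <= M) ->
  (\int[riesz_measure]_(x in (S : set Borel)) (u x)%:E = (L u)%:E)%E.
Proof.
move=> cu u0M; apply/eqP; rewrite eq_le (integral_riesz_le cu u0M)/=.
have mu := within_continuous_borel clS cu.
have cMu : C (fun x => M - u x) by apply: CB => //; exact: Ccst.
have Mu0M x : S x -> 0 <= M - u x <= M.
  by move=> /u0M/andP[u0 uM]; rewrite subr_ge0 uM lerBlDr lerDl.
have u0 (x : Borel) : S x -> (0 <= (u x)%:E)%E.
  by move=> /u0M/andP[+ _]; rewrite lee_fin.
have Mu0 (x : Borel) : S x -> (0 <= (M - u x)%:E)%E.
  by move=> /Mu0M/andP[+ _]; rewrite lee_fin.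
have := integral_riesz_le cMu Mu0M.
rewrite (LB (@Ccst M) cu).
have : (\int[riesz_measure]_(x in (S : set Borel)) (u x)%:E +
   \int[riesz_measure]_(x in (S : set Borel)) (M - u x)%:E = (L (fun=> M))%:E)%E.
  have mE (v : X -> R) : C v ->
      measurable_fun (S : set Borel) (fun x : Borel => (v x)%:E).
    by move=> cv; apply/measurable_EFinP; exact: within_continuous_borel.
  rewrite -(ge0_integralD _ mS u0 (mE _ cu) Mu0 (mE _ cMu)).
  rewrite (eq_integral (cst M%:E)); last first.
    by move=> x _; rewrite -EFinD addrC subrK.
  rewrite integral_cst//.
  have -> : riesz_measure (S : set Borel) = (L (fun=> 1))%:E.
    have : (riesz_measure (setT : set Borel) = riesz_measure (S : set Borel) +
      riesz_measure (~` S : set Borel))%E.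
      rewrite -measureU//; [by rewrite setUv|exact: measurableC|exact: setICr].
    by rewrite /= riesz_outerT riesz_outerC adde0.
  rewrite -EFinM -LZ; last exact: Ccst.
  by congr (L _)%:E; apply/funext => x; rewrite mulr1.
have aux (I J : \bar R) (a c : R) : (0 <= I)%E -> (0 <= J)%E ->
    (I + J = c%:E)%E -> (J <= (c - a)%:E)%E -> (a%:E <= I)%E.
  by case: I => [i| |] //; case: J => [j| |] // _ _ [<-]; rewrite !lee_fin; lra.
by apply: aux; exact: integral_ge0.
Qed.

End riesz_markov.

Theorem riesz_markov_representation (R : realType) (X : ptopologicalType)
    (S : set X) (L : (X -> R) -> R) :
  compact S -> closed S ->
  (forall U : set X, open U -> exists2 phi : X -> R, continuous phi &
    (forall x, 0 <= phi x) /\ U = [set x | 0 < phi x]) ->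
  (forall u v : X -> R,
    {within S, continuous u} -> {within S, continuous v} ->
    L (fun x => u x + v x) = L u + L v) ->
  (forall (a : R) (u : X -> R), {within S, continuous u} ->
    L (fun x => a * u x) = a * L u) ->
  (forall u : X -> R, {within S, continuous u} ->
    (forall x, S x -> 0 <= u x) -> 0 <= L u) ->
  exists mu : {measure set (g_sigma_algebraType (@open X)) -> \bar R},
    [/\ mu setT = (L (fun=> 1))%:E, mu (~` S) = 0%E &
     forall (u : X -> R) (M : R), {within S, continuous u} ->
       (forall x, S x -> 0 <= u x <= M) ->
       (\int[mu]_(x in (S : set (g_sigma_algebraType (@open X)))) (u x)%:E
         = (L u)%:E)%E].
Proof.
move=> cptS clS coz LD LZ L0.
exists (riesz_measure LD LZ L0 coz); split.
- by rewrite /= riesz_outerT.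
- by rewrite /= riesz_outerC.
- exact: integral_riesz.
Qed.

(** * Modulus and topology on C and C^2 *)

Section modulus.
Context {R : realType}.
Implicit Types z w : Cplx R.
Local Notation Re := (@complex.Re R).
Local Notation Im := (@complex.Im R).

(** The norm of [Cplx R] takes its values in [Cplx R] itself. Estimates are made with the
    real-valued [cmod] and carried over by this identity. *)
Lemma normr_cmodE z : `|z| = real_complex R (cmod z).
Proof. exact: normc_def. Qed.

Lemma cmod_ge0 z : 0 <= cmod z.
Proof. exact: sqrtr_ge0. Qed.

Lemma cmodM z w : cmod (z * w) = cmod z * cmod w.
Proof. by apply: complexI; rewrite rmorphM /= -!normr_cmodE normrM. Qed.

Lemma cmodD z w : cmod (z + w) <= cmod z + cmod w.
Proof. by rewrite -lecR rmorphD /= -!normr_cmodE ler_normD. Qed.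

Lemma cmodN z : cmod (- z) = cmod z.
Proof. by apply: complexI; rewrite -!normr_cmodE normrN. Qed.

Lemma cmodB z w : cmod (z - w) <= cmod z + cmod w.
Proof. by rewrite -(cmodN w); exact: cmodD. Qed.

Lemma cmodC z w : cmod (z - w) = cmod (w - z).
Proof. by rewrite -opprB cmodN. Qed.

Lemma cmodV z : cmod z^-1 = (cmod z)^-1.
Proof. by apply: complexI; rewrite fmorphV /= -!normr_cmodE normfV. Qed.

Lemma cmodX z n : cmod (z ^+ n) = cmod z ^+ n.
Proof. by apply: complexI; rewrite rmorphXn /= -!normr_cmodE normrX. Qed.

Lemma cmod_real (a : R) : cmod (real_complex R a : Cplx R) = `|a|.
Proof. by rewrite /cmod /= expr0n addr0 sqrtr_sqr. Qed.

Lemma cmod0 : cmod (0 : Cplx R) = 0.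
Proof. by apply: complexI; rewrite -normr_cmodE normr0. Qed.

Lemma cmod1 : cmod (1 : Cplx R) = 1.
Proof. by apply: complexI; rewrite -normr_cmodE normr1. Qed.

Lemma cmod_conj z : cmod (conjc z) = cmod z.
Proof. by rewrite /cmod; case: z => a b /=; rewrite sqrrN. Qed.

Lemma cmod_eq0 z : (cmod z == 0) = (z == 0).
Proof. by rewrite -(inj_eq (@complexI R)) -normr_cmodE normr_eq0. Qed.

Lemma cmod_gt0 z : (0 < cmod z) = (z != 0).
Proof. by rewrite lt_neqAle cmod_ge0 andbT eq_sym cmod_eq0. Qed.

Lemma sqr_cmod z : cmod z ^+ 2 = Re z ^+ 2 + Im z ^+ 2.
Proof. by rewrite sqr_sqrtr// addr_ge0// sqr_ge0. Qed.

Lemma Re_le_cmod z : `|Re z| <= cmod z.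
Proof. by rewrite -sqrtr_sqr ler_wsqrtr// lerDl sqr_ge0. Qed.

Lemma Im_le_cmod z : `|Im z| <= cmod z.
Proof. by rewrite -sqrtr_sqr ler_wsqrtr// lerDr sqr_ge0. Qed.

Lemma cmod_le_ReIm z : cmod z <= `|Re z| + `|Im z|.
Proof.
rewrite -(@ler_pXn2r _ 2) ?nnegrE ?cmod_ge0 ?addr_ge0// sqr_cmod.
rewrite -(real_normK (num_real (Re z))) -(real_normK (num_real (Im z))).
by rewrite sqrrD lerD2r lerDl mulrn_wge0// mulr_ge0.
Qed.

Lemma cReD z w : Re (z + w) = Re z + Re w.
Proof. by case: z; case: w. Qed.
Lemma cImD z w : Im (z + w) = Im z + Im w.
Proof. by case: z; case: w. Qed.
Lemma cReN z : Re (- z) = - Re z.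
Proof. by case: z. Qed.
Lemma cImN z : Im (- z) = - Im z.
Proof. by case: z. Qed.
Lemma cReM z w : Re (z * w) = Re z * Re w - Im z * Im w.
Proof. by case: z; case: w. Qed.
Lemma cImM z w : Im (z * w) = Re z * Im w + Im z * Re w.
Proof. by case: z => a b; case: w. Qed.

Lemma mul_conjc z : z * conjc z = real_complex R (cmod z ^+ 2).
Proof.
by rewrite sqr_cmod; case: z => a b; apply/eqP; rewrite eq_complex /=; apply/andP;
  split; apply/eqP; ring.
Qed.

Lemma norm_eq1 z : `|z| = 1 <-> cmod z = 1.
Proof. by rewrite normr_cmodE; split => [/(@complexI R _ 1)//|->]. Qed.

Lemma norm_lt1 z : (`|z| < 1) = (cmod z < 1).
Proof. by rewrite normr_cmodE -[1 in LHS]/(real_complex R 1) ltcR. Qed.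

Lemma norm_le1 z : (`|z| <= 1) = (cmod z <= 1).
Proof. by rewrite normr_cmodE -[1 in LHS]/(real_complex R 1) lecR. Qed.

Lemma gt0_real_complex (e : Cplx R) : 0 < e -> exists2 r : R, 0 < r & e = real_complex R r.
Proof.
move=> e0; have /complex_realP[r re] : (e : R[i]) \is Num.real by exact: gtr0_real.
by exists r => //; move: e0; rewrite re -[0 in X in X -> _]/(real_complex R 0) ltcR.
Qed.

Lemma nbhs_cmodP z (A : set (Cplx R)) :
  nbhs z A <-> exists2 e : R, 0 < e & forall w, cmod (z - w) < e -> A w.
Proof.
split=> [/nbhs_ballP[e /gt0_real_complex[r r0 ->]] h|[e e0 h]].
  by exists r => // w zw; apply: h; rewrite -ball_normE /= normr_cmodE ltcR.
apply/nbhs_ballP; exists (real_complex R e) => /=; first by rewrite ltcR.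
by move=> w; rewrite -ball_normE /= normr_cmodE ltcR; exact: h.
Qed.

(** A real-valued l^1 distance inducing the product topology, so that neighbourhoods and continuity
    can be handled with real epsilons. *)
Definition cdist (x y : C2 R) : R := cmod (x.1 - y.1) + cmod (x.2 - y.2).

Lemma nbhs_cdistP (x : C2 R) (A : set (C2 R)) :
  nbhs x A <-> exists2 e : R, 0 < e & forall y, cdist x y < e -> A y.
Proof.
split=> [[[U V] [/nbhs_cmodP[d d0 dU] /nbhs_cmodP[e e0 eV]] UV]|[e e0 h]].
  exists (Num.min d e); first by rewrite lt_min d0.
  move=> y; rewrite lt_min => /andP[yd ye]; apply: UV; split => /=.
    by apply: dU; apply: le_lt_trans yd; rewrite lerDl cmod_ge0.
  by apply: eV; apply: le_lt_trans ye; rewrite lerDr cmod_ge0.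
have e2 : 0 < e / 2 by rewrite divr_gt0.
exists ([set w | cmod (x.1 - w) < e / 2], [set w | cmod (x.2 - w) < e / 2]).
  by split; apply/nbhs_cmodP; exists (e / 2).
by move=> [w1 w2] /= [h1 h2]; apply: h; rewrite [e]splitr ltrD.
Qed.

Lemma cdist_ge0 x y : 0 <= cdist x y.
Proof. by rewrite addr_ge0// cmod_ge0. Qed.

Lemma cdistC (x y : C2 R) : cdist x y = cdist y x.
Proof. by rewrite /cdist cmodC (cmodC x.2). Qed.

Lemma cdistxx x : cdist x x = 0.
Proof. by rewrite /cdist !subrr cmod0 addr0. Qed.

Lemma cdist_triangle (x y z : C2 R) : cdist x z <= cdist x y + cdist y z.
Proof.
rewrite /cdist; have := cmodD (x.1 - y.1) (y.1 - z.1).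
have := cmodD (x.2 - y.2) (y.2 - z.2); rewrite !subrKA; lra.
Qed.

Lemma cvg_realP (x : C2 R) (D : set (C2 R)) (u : C2 R -> R) (l : R) :
  u @ within D (nbhs x) --> l <->
  forall e, 0 < e -> exists2 d : R, 0 < d &
    forall y, D y -> cdist x y < d -> `|l - u y| < e.
Proof.
split=> [/cvgrPdist_lt h e e0|h].
  by have /nbhs_cdistP[d d0 hd] := h e e0; exists d => // y Dy /hd; apply.
apply/cvgrPdist_lt => e e0; have [d d0 hd] := h e e0.
by apply/nbhs_cdistP; exists d => // y /[swap]; exact: hd.
Qed.

Lemma cvg_complexP (x : C2 R) (D : set (C2 R)) (u : C2 R -> Cplx R) (l : Cplx R) :
  u @ within D (nbhs x) --> l <->
  forall e : R, 0 < e -> exists2 d : R, 0 < d &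
    forall y, D y -> cdist x y < d -> cmod (l - u y) < e.
Proof.
split=> [/cvgrPdist_lt h e e0|h].
  have e0' : 0 < (real_complex R e : Cplx R) by rewrite ltcR.
  have /nbhs_cdistP[d d0 hd] := h _ e0'; exists d => // y Dy /hd /(_ Dy).
  by rewrite normr_cmodE ltcR.
apply/cvgrPdist_lt => _ /gt0_real_complex[e e0 ->]; have [d d0 hd] := h e e0.
by apply/nbhs_cdistP; exists d => // y yd Dy; rewrite normr_cmodE ltcR; exact: hd.
Qed.

Lemma within_continuous_realP (D : set (C2 R)) (u : C2 R -> R) :
  {within D, continuous u} <-> forall x, D x -> forall e, 0 < e ->
    exists2 d : R, 0 < d & forall y, D y -> cdist x y < d -> `|u x - u y| < e.
Proof.
split=> [/subspace_continuousP cu x Dx|h].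
  by apply/cvg_realP; exact: cu.
apply/subspace_continuousP => x Dx; apply/cvg_realP; exact: h.
Qed.

Lemma within_continuous_complexP (D : set (C2 R)) (u : C2 R -> Cplx R) :
  {within D, continuous u} <-> forall x, D x -> forall e : R, 0 < e ->
    exists2 d : R, 0 < d & forall y, D y -> cdist x y < d -> cmod (u x - u y) < e.
Proof.
split=> [/subspace_continuousP cu x Dx|h].
  by apply/cvg_complexP; exact: cu.
apply/subspace_continuousP => x Dx; apply/cvg_complexP; exact: h.
Qed.

End modulus.

(** * Bidisc algebra and its uniform closure *)

Lemma compact_pos_lower_bound (T : topologicalType) (R : realType) (K : set T)
    (u : T -> R) : compact K -> {within K, continuous u} ->
  (forall x, K x -> 0 < u x) -> exists2 d, 0 < d & forall x, K x -> d <= u x.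
Proof.
move=> cK cu u0; have [->|/set0P K0] := eqVneq K set0; first by exists 1.
have [c /set_mem Kc h] := compact_EVT_min K0 cK cu.
by exists (u c); [exact: u0|move=> x Kx; apply: h; rewrite inE].
Qed.

Lemma compact_upper_bound (T : topologicalType) (R : realType) (K : set T)
    (u : T -> R) : compact K -> {within K, continuous u} ->
  exists2 M, 0 <= M & forall x, K x -> u x <= M.
Proof.
move=> cK cu; have [->|/set0P K0] := eqVneq K set0; first by exists 0.
have [c /set_mem Kc h] := compact_EVT_max K0 cK cu.
exists (Num.max 0 (u c)) => [|x Kx]; first by rewrite le_max lexx.
by rewrite le_max h ?orbT// inE.
Qed.

Section bidisc.
Context {R : realType}.
Implicit Types (f g : C2 R -> Cplx R) (K : set (C2 R)).

(** The function is the distance to the complement of U, which is 1-Lipschitz and positive exactly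
    on U. An empty complement is treated apart, because the infimum of the empty set is 0 by
    convention. *)
Lemma open_cozero (U : set (C2 R)) : open U ->
  exists2 phi : C2 R -> R, continuous phi &
    (forall x, 0 <= phi x) /\ U = [set x | 0 < phi x].
Proof.
move=> oU; have [UT|/set0P[y0 Uy0]] := eqVneq (~` U) set0.
  exists (fun=> 1); first by move=> x; exact: cvg_cst.
  split=> [x|]; first exact: ler01.
  rewrite -[U]setCK UT setC0; apply/seteqP; split => x _ //=.
pose phi x := inf [set cdist x y | y in ~` U].
have lb x y : ~ U y -> phi x <= cdist x y.
  move=> Uy; apply: ge_inf; last by exists y.
  by exists 0 => _ [z _ <-]; exact: cdist_ge0.
have glb x c : (forall y, ~ U y -> c <= cdist x y) -> c <= phi x.
  move=> h; apply: lb_le_inf; first by exists (cdist x y0), y0.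
  by move=> _ [z Uz <-]; exact: h.
have lip x y : phi x - phi y <= cdist x y.
  rewrite lerBlDr -lerBlDl; apply: (glb) => z Uz; rewrite lerBlDl.
  exact: le_trans (lb x z Uz) (cdist_triangle x y z).
exists phi.
  move=> x; apply/cvgrPdist_lt => e e0; apply/nbhs_cdistP; exists e => // y xy.
  rewrite ltr_norml; have := lip x y; have := lip y x; rewrite (cdistC y x); lra.
split=> [x|]; first by apply: glb => y _; exact: cdist_ge0.
apply/seteqP; split => [x Ux /=|x /= phix].
  have /nbhs_cdistP[e e0 eU] : nbhs x U by exact: open_nbhs_nbhs.
  apply: lt_le_trans e0 _; apply: glb => y Uy.
  by rewrite leNgt; apply/negP => /eU.
by apply: contrapT => Ux; have := lb x x Ux; rewrite cdistxx leNgt phix.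
Qed.

Lemma bidisc_algebra_differentiable f :
  (forall z, closed_bidisc z -> differentiable f z) -> bidisc_algebra f.
Proof.
move=> df; split=> [|z [z1 z2]]; last by apply: df; split; exact: ltW.
apply: continuous_in_subspaceT => z; rewrite inE => zb.
exact: differentiable_continuous (df z zb).
Qed.

Lemma bidisc_algebra_cst (c : Cplx R) : bidisc_algebra (fun=> c).
Proof.
by apply: bidisc_algebra_differentiable => z _; exact: differentiable_cst.
Qed.

Lemma differentiable_fst (z : C2 R) : differentiable (fst : C2 R -> Cplx R) z.
Proof. by apply: linear_differentiable => y; exact: cvg_fst. Qed.

Lemma differentiable_snd (z : C2 R) : differentiable (snd : C2 R -> Cplx R) z.
Proof. by apply: linear_differentiable => y; exact: cvg_snd. Qed.

Lemma bidisc_algebra_fst : bidisc_algebra (fun z : C2 R => z.1).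
Proof.
by apply: bidisc_algebra_differentiable => z _; exact: differentiable_fst.
Qed.

Lemma bidisc_algebra_snd : bidisc_algebra (fun z : C2 R => z.2).
Proof.
by apply: bidisc_algebra_differentiable => z _; exact: differentiable_snd.
Qed.

Lemma bidisc_algebraD f g : bidisc_algebra f -> bidisc_algebra g ->
  bidisc_algebra (fun z => f z + g z).
Proof.
move=> [cf df] [cg dg]; split=> [x|z zb].
  by apply: cvgD; [exact: cf|exact: cg].
exact: (differentiableD (df z zb) (dg z zb)).
Qed.

Lemma bidisc_algebraM f g : bidisc_algebra f -> bidisc_algebra g ->
  bidisc_algebra (fun z => f z * g z).
Proof.
move=> [cf df] [cg dg]; split=> [x|z zb].
  by apply: cvgM; [exact: cf|exact: cg].
exact: (differentiableM (df z zb) (dg z zb)).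
Qed.

Lemma one_sub_mul_neq0 (a w : Cplx R) : cmod a < 1 -> cmod w <= 1 -> 1 - a * w != 0.
Proof.
move=> a1 w1; rewrite subr_eq0; apply/eqP => /(congr1 (@cmod R)).
rewrite cmod1 cmodM => h; have := ler_pM (cmod_ge0 a) (cmod_ge0 w) (lexx _) w1.
by rewrite -h mulr1 leNgt a1.
Qed.

Lemma bidisc_algebra_cauchy_kernel (a b : Cplx R) : cmod a < 1 -> cmod b < 1 ->
  bidisc_algebra (fun z => (1 - a * z.1)^-1 * (1 - b * z.2)^-1).
Proof.
move=> a1 b1; apply: bidisc_algebra_differentiable => z [].
rewrite !norm_le1 => z1 z2.
apply: (@differentiableM _ _ (fun z : C2 R => (1 - a * z.1)^-1)
  (fun z : C2 R => (1 - b * z.2)^-1)); apply: differentiableV;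
  do ?exact: one_sub_mul_neq0.
  apply: differentiableB; first exact: differentiable_cst.
  apply: (@differentiableM _ _ (cst a) fst); first exact: differentiable_cst.
  exact: differentiable_fst.
apply: differentiableB; first exact: differentiable_cst.
apply: (@differentiableM _ _ (cst b) snd); first exact: differentiable_cst.
exact: differentiable_snd.
Qed.

Lemma in_A0D f g : in_A0 f -> in_A0 g -> in_A0 (fun z => f z + g z).
Proof.
move=> [f' [Af ff]] [g' [Ag gg]]; exists (fun z => f' z + g' z).
by split=> [|z zT]; [exact: bidisc_algebraD|rewrite ff// gg// mulrDr].
Qed.

Lemma in_A0Ml a f : bidisc_algebra a -> in_A0 f -> in_A0 (fun z => a z * f z).
Proof.
move=> Aa [f' [Af ff]]; exists (fun z => a z * f' z).
by split=> [|z zT]; [exact: bidisc_algebraM|rewrite ff// mulrCA].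
Qed.

Lemma in_A0Z (c : Cplx R) f : in_A0 f -> in_A0 (fun z => c * f z).
Proof. by apply: in_A0Ml; exact: bidisc_algebra_cst. Qed.

Lemma in_A0_0 : in_A0 (fun=> 0 : Cplx R).
Proof.
by exists (fun=> 0); split=> [|z _]; [exact: bidisc_algebra_cst|rewrite mulr0].
Qed.

(** * The uniform closure of the bidisc algebra on a compact set *)

Definition in_sup_closure K g := forall e : R, 0 < e ->
  exists2 a, bidisc_algebra a & forall z, K z -> cmod (a z - g z) < e.

Section sup_closure.
Variable K : set (C2 R).
Hypotheses (cK : compact K) (Kb : K `<=` @closed_bidisc R).

Lemma within_continuous_cmod g : {within K, continuous g} ->
  {within K, continuous (fun z => cmod (g z))}.
Proof.
move/within_continuous_complexP => cg; apply/within_continuous_realP => x Kx e e0.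
have [d d0 h] := cg x Kx e e0; exists d => // y Ky /(h y Ky).
apply: le_lt_trans; rewrite ler_norml; apply/andP; split.
  by rewrite lerNl opprB lerBlDr cmodC -[X in X <= _](congr1 (@cmod R) (subrK (g x) _)) cmodD.
by rewrite lerBlDr -[X in X <= _](congr1 (@cmod R) (subrK (g y) _)) cmodD.
Qed.

Lemma bidisc_algebra_within a : bidisc_algebra a -> {within K, continuous a}.
Proof. by move=> [ca _]; exact: continuous_subspaceW ca. Qed.

Lemma bidisc_algebra_bounded a : bidisc_algebra a ->
  exists2 M, 0 <= M & forall z, K z -> cmod (a z) <= M.
Proof.
move=> Aa; apply: compact_upper_bound => //.
exact/within_continuous_cmod/bidisc_algebra_within.
Qed.

Lemma sup_closure_bounded g : in_sup_closure K g ->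
  exists2 M, 0 <= M & forall z, K z -> cmod (g z) <= M.
Proof.
move=> /(_ 1 ltr01)[a Aa ag]; have [M M0 aM] := bidisc_algebra_bounded Aa.
exists (M + 1) => [|z Kz]; first by rewrite addr_ge0.
rewrite -(subKr (a z) (g z)); apply: le_trans (cmodB _ _) _.
by apply: lerD; [exact: aM|exact/ltW/ag].
Qed.

Lemma sup_closure_alg a : bidisc_algebra a -> in_sup_closure K a.
Proof. by move=> Aa e e0; exists a => // z _; rewrite subrr cmod0. Qed.

Lemma sup_closure_ext f g : (forall z, K z -> f z = g z) ->
  in_sup_closure K f -> in_sup_closure K g.
Proof.
by move=> fg h e /h[a Aa ag]; exists a => // z Kz; rewrite -fg//; exact: ag.
Qed.

Lemma sup_closure_lim g : (forall e : R, 0 < e -> exists2 f, in_sup_closure K f &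
    forall z, K z -> cmod (f z - g z) < e) -> in_sup_closure K g.
Proof.
move=> h e e0; have e2 : 0 < e / 2 by rewrite divr_gt0.
have [f /(_ _ e2)[a Aa af] fg] := h _ e2; exists a => // z Kz.
rewrite -(subrKA (f z)); apply: le_lt_trans (cmodD _ _) _.
by rewrite [e]splitr ltrD ?af ?fg.
Qed.

Lemma sup_closureD f g : in_sup_closure K f -> in_sup_closure K g ->
  in_sup_closure K (fun z => f z + g z).
Proof.
move=> hf hg e e0; have e2 : 0 < e / 2 by rewrite divr_gt0.
have [a Aa af] := hf _ e2; have [b Ab bg] := hg _ e2.
exists (fun z => a z + b z); first exact: bidisc_algebraD.
move=> z Kz; rewrite opprD addrACA; apply: le_lt_trans (cmodD _ _) _.
by rewrite [e]splitr ltrD ?af ?bg.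
Qed.

(** The approximant b of g is chosen first, against a bound of f; only then is a chosen near f,
    against a bound of b. This order matches the splitting a b - f g = (a - f) b + f (b - g). *)
Lemma sup_closureM f g : in_sup_closure K f -> in_sup_closure K g ->
  in_sup_closure K (fun z => f z * g z).
Proof.
move=> hf hg; have [M M0 fM] := sup_closure_bounded hf.
apply: sup_closure_lim => e e0.
have d0 : 0 < e / (2 * (M + 1)) by rewrite divr_gt0// mulr_gt0// ltr_wpDl.
have [b Ab bg] := hg _ d0.
have [N N0 bN] := bidisc_algebra_bounded Ab.
have d'0 : 0 < e / (2 * (N + 1)) by rewrite divr_gt0// mulr_gt0// ltr_wpDl.
have [a Aa af] := hf _ d'0.
exists (fun z => a z * b z); first exact/sup_closure_alg/bidisc_algebraM.
move=> z Kz; have -> : a z * b z - f z * g z =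
  (a z - f z) * b z + f z * (b z - g z) by ring.
apply: le_lt_trans (cmodD _ _) _; rewrite !cmodM [e]splitr.
have aux (x y B : R) : 0 <= x -> x < e / (2 * (B + 1)) -> 0 <= y -> y <= B -> x * y < e / 2.
  move=> x0 xe y0 yB; have B1 : 0 < B + 1 by rewrite ltr_wpDl// (le_trans y0).
  apply: (@le_lt_trans _ _ (x * (B + 1))).
    by rewrite ler_wpM2l// (le_trans yB)// lerDl.
  by move: xe; rewrite ltr_pdivlMr ?mulr_gt0// mulrCA -ltr_pdivlMl// mulrC [_^-1 * _]mulrC.
apply: ltrD; first by apply: (aux _ _ N); rewrite ?cmod_ge0 ?af ?bN.
by rewrite mulrC; apply: (aux _ _ M); rewrite ?cmod_ge0 ?bg ?fM.
Qed.

Lemma sup_closure_cst (c : Cplx R) : in_sup_closure K (fun=> c).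
Proof. exact/sup_closure_alg/bidisc_algebra_cst. Qed.

Lemma sup_closureX f n : in_sup_closure K f -> in_sup_closure K (fun z => f z ^+ n).
Proof.
move=> hf; elim: n => [|n ih].
  by apply: sup_closure_ext (sup_closure_cst 1) => z _; rewrite expr0.
by apply: sup_closure_ext (sup_closureM hf ih) => z _; rewrite exprS.
Qed.

Lemma sup_closure_sum I (r : seq I) (F : I -> C2 R -> Cplx R) :
  (forall i, in_sup_closure K (F i)) ->
  in_sup_closure K (fun z => \sum_(i <- r) F i z).
Proof.
move=> hF; elim: r => [|i r ih].
  by apply: sup_closure_ext (sup_closure_cst 0) => z _; rewrite big_nil.
by apply: sup_closure_ext (sup_closureD (hF i) ih) => z _; rewrite big_cons.
Qed.

(* Geometric series: for small c > 0, 1 - c g is a uniform contraction on K. *)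
Lemma sup_closureV g (d : R) : in_sup_closure K g -> 0 < d ->
  (forall z, K z -> d <= complex.Re (g z)) -> in_sup_closure K (fun z => (g z)^-1).
Proof.
move=> hg d0 gd; have [M0 M00 gM0] := sup_closure_bounded hg.
(* Adding d makes M >= d, so that 1 - d^2 / M^2 has a real square root. *)
pose M := M0 + d + 1; have M_gt0 : 0 < M by rewrite /M; lra.
have gM z : K z -> cmod (g z) <= M by move=> /gM0; rewrite /M; lra.
(* From Re g >= d and |g| <= M, |1 - c g|^2 <= 1 - 2 c d + c^2 M^2. The value c = d / M^2 minimises
   the right side, and the minimum is q^2. *)
pose c := d / M ^+ 2; pose q := Num.sqrt (1 - d ^+ 2 / M ^+ 2).
have c0 : 0 < c by rewrite divr_gt0// exprn_gt0.
have dM : d ^+ 2 / M ^+ 2 <= 1.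
  rewrite ler_pdivrMr ?exprn_gt0// mul1r ler_pXn2r ?nnegrE ?ltW//.
  by rewrite /M; lra.
have q1 : q < 1.
  rewrite -[ltRHS]sqrtr1 ltr_sqrt// ltrBlDr ltrDl.
  by rewrite divr_gt0// exprn_gt0.
pose C : Cplx R := real_complex R c.
have contr z : K z -> cmod (1 - C * g z) <= q.
  move=> Kz; rewrite -(@ler_pXn2r _ 2) ?nnegrE ?cmod_ge0 ?sqrtr_ge0//.
  rewrite sqr_cmod /q sqr_sqrtr ?subr_ge0//.
  rewrite !(cReD, cImD, cReN, cImN, cReM, cImM) /=.
  have : complex.Re (g z) ^+ 2 + complex.Im (g z) ^+ 2 <= M ^+ 2.
    by rewrite -sqr_cmod ler_pXn2r ?nnegrE ?cmod_ge0 ?gM// ltW.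
  have := gd z Kz; set x := complex.Re _; set y := complex.Im _ => xd xyM.
  have -> : d ^+ 2 / M ^+ 2 = c * d by rewrite /c; ring.
  have cM : c * M ^+ 2 = d by rewrite /c divfK// expf_neq0// gt_eqF.
  have h1 : c * (c * (x ^+ 2 + y ^+ 2)) <= c * d.
    by rewrite ler_pM2l// -cM ler_pM2l.
  have h2 : c * d <= c * x by rewrite ler_pM2l.
  by nra.
have gneq0 z : K z -> g z != 0.
  move=> Kz; apply: contraTneq (gd z Kz) => ->; by rewrite -ltNge.
pose s n z := C * \sum_(k <- iota 0 n) (1 - C * g z) ^+ k.
have hs n : in_sup_closure K (s n).
  apply: sup_closureM; first exact: sup_closure_cst.
  apply: sup_closure_sum => k; apply: sup_closureX.
  apply: sup_closureD; first exact: sup_closure_cst.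
  apply: (@sup_closure_ext (fun z => - C * g z)); first by move=> z _; rewrite mulNr.
  by apply: sup_closureM => //; exact: sup_closure_cst.
have sE n z : K z -> s n z - (g z)^-1 = - ((1 - C * g z) ^+ n / g z).
  move=> Kz; have g0 := gneq0 z Kz.
  apply: (mulIf g0); rewrite mulrBl mulNr !divfK// mulVf//.
  rewrite /s; elim: n => [|n ih]; first by rewrite big_nil mulr0 mul0r sub0r expr0.
  rewrite -addn1 iotaD big_cat big_seq1 add0n addn1 exprS /=.
  move: ih => /(canRL (subrK _)) ih.
  by rewrite mulrDr mulrDl ih; ring.
have q0 : 0 <= q by exact: sqrtr_ge0.
apply: sup_closure_lim => e e0.
have de : 0 < d * e by rewrite mulr_gt0.
have [n qn] : exists n, q ^+ n < d * e.
  have : q ^+ n @[n --> \oo] --> 0 by apply: cvg_expr; rewrite ger0_norm.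
  move=> /cvgrPdist_lt/(_ _ de)[n _ /(_ n (leqnn n))] /=.
  by rewrite sub0r normrN ger0_norm ?exprn_ge0// => h; exists n.
exists (s n) => // z Kz; rewrite sE// cmodN cmodM cmodV cmodX.
have dg : d <= cmod (g z).
  exact: le_trans (gd z Kz) (le_trans (ler_norm _) (Re_le_cmod _)).
rewrite ltr_pdivrMr; last exact: lt_le_trans d0 dg.
apply: (@le_lt_trans _ _ (q ^+ n)); first by rewrite lerXn2r ?nnegrE ?cmod_ge0 ?contr.
by apply: lt_le_trans qn _; rewrite mulrC ler_wpM2l// ltW.
Qed.

End sup_closure.
End bidisc.

(** * Density of A_0 when some element has positive real part *)

(* Products carry no canonical ptopologicalType structure. *)
Definition C2_ptopological (R : realType) : ptopologicalType :=
  HB.pack (C2 R) (Topological.on (C2 R)) (Pointed.on (C2 R)).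

Section density.
Context {R : realType}.
Implicit Types (f g : C2 R -> Cplx R) (K : set (C2 R)).

Lemma torus_cmod (z : C2 R) : torus2 z -> cmod z.1 = 1 /\ cmod z.2 = 1.
Proof. by move=> [/norm_eq1 z1 /norm_eq1 z2]. Qed.

Lemma torus2_closed_bidisc : @torus2 R `<=` @closed_bidisc R.
Proof. by move=> z [z1 z2]; split; rewrite ?z1 ?z2. Qed.

Lemma mulC_unit (z : Cplx R) : cmod z = 1 -> z * conjc z = 1.
Proof. by move=> z1; rewrite mul_conjc z1 expr1n. Qed.

Lemma open_cdist_ball (x : C2 R) (r : R) : open [set y | cdist x y < r].
Proof.
rewrite openE => y /= xy; apply/nbhs_cdistP; exists (r - cdist x y).
  by rewrite subr_gt0.
move=> z yz /=; apply: le_lt_trans (cdist_triangle x y z) _.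
by rewrite -ltrBrDl.
Qed.

Lemma compact_cdist_net K (r : R) : compact K -> 0 < r ->
  exists2 s : seq (C2 R), (forall x, x \in s -> K x) &
    forall z, K z -> exists2 x, x \in s & cdist x z < r.
Proof.
move=> cK r0.
have covK : cover_compact (K : set (C2_ptopological R)).
  by rewrite -compact_cover.
have [|D DK Dcov] := covK (C2_ptopological R) K
    (fun x => [set y | cdist x y < r]) (fun x _ => @open_cdist_ball x r).
  by move=> z Kz; exists z => //=; rewrite cdistxx.
exists (finmap.enum_fset D) => [x xD|z Kz]; first by have := DK x xD; rewrite inE.
by have [x xD xz] := Dcov z Kz; exists x.
Qed.

Lemma compact_uniform_continuous K g (e : R) : compact K ->
  {within K, continuous g} -> 0 < e ->
  exists2 d : R, 0 < d & forall x y, K x -> K y -> cdist x y < d ->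
    cmod (g x - g y) < e.
Proof.
move=> cK /within_continuous_complexP cg e0.
have e2 : 0 < e / 2 by rewrite divr_gt0.
have /compact_near_coveringP/near_covering_withinP ncK := cK.
have := ncK R (0^'+) (fun d x => forall y, K y -> cdist x y < d ->
  cmod (g x - g y) < e) _ _.
move=> [|d /= d0 h].
  move=> x Kx; have [r r0 hr] := cg x Kx _ e2.
  have r2 : 0 < r / 2 by rewrite divr_gt0.
  exists ([set y | cdist x y < r / 2], [set d | d < r / 2]).
    split; first by apply/nbhs_cdistP; exists (r / 2).
    exact: nbhs_right_lt.
  move=> [y d] /= [xy dr] Ky z Kz yz.
  rewrite -(subrKA (g x)); apply: le_lt_trans (cmodD _ _) _.
  rewrite [e]splitr cmodC; apply: ltrD; apply: hr => //.
    by apply: lt_trans xy _; lra.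
  by apply: le_lt_trans (cdist_triangle x y z) _; lra.
have d2 : 0 < d / 2 by rewrite divr_gt0.
exists (d / 2) => // x y Kx Ky xy.
apply: (h (d / 2)) => //.
by rewrite /= sub0r normrN gtr0_norm//; lra.
Qed.

(** A peak function at x that is a polynomial in z1, z2 and their conjugates. On the torus each |z_j
    - x_j|^2 is at most 4, so the divisor 8 keeps it between 0 and 1. *)
Definition bump (x z : C2 R) : R :=
  1 - (cmod (z.1 - x.1) ^+ 2 + cmod (z.2 - x.2) ^+ 2) / 8.

Lemma bump_ge0 x z : torus2 x -> torus2 z -> 0 <= bump x z.
Proof.
move=> /torus_cmod[x1 x2] /torus_cmod[z1 z2]; rewrite /bump.
have := cmodB z.1 x.1; have := cmodB z.2 x.2; rewrite x1 x2 z1 z2.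
have := cmod_ge0 (z.1 - x.1); have := cmod_ge0 (z.2 - x.2).
set a := cmod _; set b := cmod _ => a0 b0 a2 b2.
have : a ^+ 2 <= 4 by nra. have : b ^+ 2 <= 4 by nra. lra.
Qed.

(** Here and in [bump_far], the constants 8 and 16 differ because [cdist] is an l^1 distance: a^2 +
    b^2 lies between (a + b)^2 / 2 and (a + b)^2. *)
Lemma bump_near x z (r : R) : cdist x z < r -> 1 - r ^+ 2 / 8 <= bump x z.
Proof.
rewrite /cdist /bump !(cmodC (z.1)) (cmodC z.2).
have := cmod_ge0 (x.1 - z.1); have := cmod_ge0 (x.2 - z.2).
set a := cmod _; set b := cmod _ => a0 b0 abr.
have : b ^+ 2 + a ^+ 2 <= r ^+ 2 by nra.
lra.
Qed.

Lemma bump_far x z (r : R) : 0 <= r -> r <= cdist x z -> bump x z <= 1 - r ^+ 2 / 16.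
Proof.
move=> r0; rewrite /cdist /bump (cmodC (z.1)) (cmodC z.2).
have := cmod_ge0 (x.1 - z.1); have := cmod_ge0 (x.2 - z.2).
set a := cmod _; set b := cmod _ => a0 b0 abr.
have : r ^+ 2 <= 2 * (b ^+ 2 + a ^+ 2) by have := sqr_ge0 (a - b); nra.
lra.
Qed.

Section approximation.
Variable K : set (C2 R).
Hypotheses (cK : compact K) (KT : K `<=` @torus2 R).
Hypothesis conj1 : in_sup_closure K (fun z => conjc z.1).
Hypothesis conj2 : in_sup_closure K (fun z => conjc z.2).

Let Kb : K `<=` @closed_bidisc R.
Proof. exact: subset_trans KT torus2_closed_bidisc. Qed.

Lemma sup_closure_bump x n :
  in_sup_closure K (fun z => real_complex R (bump x z ^+ n)).
Proof.
apply: (@sup_closure_ext _ _ (fun z => (1 + (- 8^-1) *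
   ((z.1 + - x.1) * (conjc z.1 + - conjc x.1) +
    (z.2 + - x.2) * (conjc z.2 + - conjc x.2))) ^+ n)).
  move=> z Kz; rewrite rmorphXn /=; congr (_ ^+ _).
  rewrite -!rmorphB !mul_conjc -rmorphD /= /bump rmorphB rmorphM fmorphV /=.
  by rewrite rmorph1 rmorph_nat mulNr mulrC.
have cst c := @sup_closure_cst R K c.
apply: sup_closureX => //; apply: sup_closureD => //; apply: sup_closureM => //.
by apply: sup_closureD => //; apply: sup_closureM => //; apply: sup_closureD => //;
  apply: sup_closure_alg; [exact: bidisc_algebra_fst|exact: bidisc_algebra_snd].
Qed.

(* Stone-Weierstrass for K: normalised high powers of the bumps centred at a
   finite net form an approximate partition of unity. *)
Lemma sup_closure_continuous g : {within K, continuous g} -> in_sup_closure K g.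
Proof.
move=> cg; apply: sup_closure_lim => e e0.
have e4 : 0 < e / 4 by rewrite divr_gt0.
have [d0 d0_gt0 gd0] := compact_uniform_continuous cK cg e4.
pose d := Num.min d0 1; have d_gt0 : 0 < d by rewrite lt_min d0_gt0 ltr01.
have d1 : d <= 1 by rewrite ge_min lexx orbT.
have gd x y : K x -> K y -> cdist x y < d -> cmod (g x - g y) < e / 4.
  by move=> Kx Ky xy; apply: gd0 => //; apply: lt_le_trans xy _; rewrite ge_min lexx.
have d2 : 0 < d / 2 by rewrite divr_gt0.
have [s sK snet] := compact_cdist_net cK d2.
have [M M0 gM] := compact_upper_bound cK (within_continuous_cmod cg).
(* The bump at a net point within d / 2 of z is at least [al] = 1 - d^2 / 32, while bumps centred at
   distance d or more are at most [be]. The net of radius d / 2 makes [be] < [al], and d <= 1 makes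
   [be] nonnegative. *)
pose al := 1 - (d / 2) ^+ 2 / 8; pose be := 1 - d ^+ 2 / 16.
have albe : 0 <= be < al by rewrite /al /be; apply/andP; split; nra.
have al0 : 0 < al by case/andP: albe; apply: le_lt_trans.
(* The far centres contribute at most size s times 2 M be^n, against a total weight of at least
   al^n. The added 1 makes C positive even for an empty net. *)
pose C := (size s)%:R * (2 * M) + 1 : R.
have C0 : 0 < C by rewrite ltr_wpDl// mulr_ge0// mulr_ge0.
have [n qn] : exists n, C * (be / al) ^+ n < e / 4.
  have q0 : 0 <= be / al by case/andP: albe => ? _; rewrite divr_ge0// ltW.
  have : (be / al) ^+ n @[n --> \oo] --> 0.
    apply: cvg_expr; rewrite ger0_norm// ltr_pdivrMr// mul1r.
    by case/andP: albe.
  have eC : 0 < e / 4 / C by rewrite divr_gt0.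
  move=> /cvgrPdist_lt/(_ _ eC)[n _ /(_ n (leqnn n))] /=.
  rewrite sub0r normrN ger0_norm ?exprn_ge0// => h; exists n.
  by rewrite mulrC -ltr_pdivlMr.
pose B z := \sum_(x <- s) bump x z ^+ n.
have bump0 x z : x \in s -> K z -> 0 <= bump x z.
  by move=> /sK/KT Tx /KT Tz; exact: bump_ge0.
have Bal z : K z -> al ^+ n <= B z.
  move=> Kz; have [x xs xz] := snet z Kz.
  rewrite /B (big_rem x xs) /= -[al ^+ n]addr0 lerD//.
    by rewrite lerXn2r ?nnegrE ?(ltW al0) ?bump0// bump_near.
  by rewrite big_seq sumr_ge0// => y /mem_rem ys; rewrite exprn_ge0// bump0.
have aln : 0 < al ^+ n by rewrite exprn_gt0.
have BV : in_sup_closure K (fun z => (real_complex R (B z))^-1).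
  apply: (@sup_closureV _ _ cK Kb _ (al ^+ n)) => //.
  apply: (@sup_closure_ext _ _ (fun z => \sum_(x <- s) real_complex R (bump x z ^+ n))).
    by move=> z _; rewrite /B rmorph_sum.
  by apply: sup_closure_sum => x; exact: sup_closure_bump.
pose G z := (\sum_(x <- s) g x * real_complex R (bump x z ^+ n)) * (real_complex R (B z))^-1.
exists G.
  apply: sup_closureM => //; apply: sup_closure_sum => x.
  by apply: sup_closureM => //; [exact: sup_closure_cst|exact: sup_closure_bump].
move=> z Kz; have B0 : 0 < B z := lt_le_trans aln (Bal z Kz).
have BC0 : real_complex R (B z) != 0 by rewrite fmorph_eq0 gt_eqF.
have -> : G z - g z =
   (\sum_(x <- s) (g x - g z) * real_complex R (bump x z ^+ n)) / real_complex R (B z).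
  rewrite /G; under [in RHS]eq_bigr do rewrite mulrBl.
  by rewrite sumrB -mulr_sumr mulrBl -rmorph_sum /= -/(B z) mulfK.
rewrite cmodM cmodV cmod_real gtr0_norm// ltr_pdivrMr//.
have sum_le (r : seq (C2 R)) (F : C2 R -> Cplx R) :
    cmod (\sum_(x <- r) F x) <= \sum_(x <- r) cmod (F x).
  elim: r => [|x r ih]; first by rewrite !big_nil cmod0.
  by rewrite !big_cons; apply: le_trans (cmodD _ _) _; rewrite lerD2l.
apply: le_lt_trans (sum_le _ _) _.
(* Centres near z are controlled by uniform continuity of g, far ones by the decay of the bump.
   Adding both bounds for every centre avoids splitting the sum. *)
apply: (@le_lt_trans _ _ (\sum_(x <- s) (e / 4 * bump x z ^+ n + 2 * M * be ^+ n))).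
  rewrite big_seq [leRHS]big_seq; apply: ler_sum => x xs.
  have Kx := sK x xs; have b0 := bump0 x z xs Kz.
  rewrite cmodM cmod_real ger0_norm ?exprn_ge0//.
  have [xz|xz] := ltP (cdist x z) d.
    rewrite -[leLHS]addr0 lerD//.
      by rewrite ler_wpM2r ?exprn_ge0// ltW// gd.
    by rewrite !mulr_ge0// exprn_ge0//; case/andP: albe.
  rewrite -[leLHS]add0r lerD//; first by rewrite mulr_ge0 ?exprn_ge0// ltW.
  apply: ler_pM; rewrite ?cmod_ge0 ?exprn_ge0//.
    by apply: le_trans (cmodB _ _) _; have := gM x Kx; have := gM z Kz; lra.
  rewrite lerXn2r ?nnegrE//; first by case/andP: albe.
  by apply: bump_far => //; exact: ltW.
rewrite big_split /= -mulr_sumr -/(B z).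
have -> : \sum_(x <- s) 2 * M * be ^+ n = (size s)%:R * (2 * M) * be ^+ n.
  by rewrite big_const_seq count_predT iter_addr_0 -[LHS]mulr_natl mulrA.
apply: (@le_lt_trans _ _ (e / 4 * B z + C * be ^+ n)).
  rewrite lerD2l ler_wpM2r ?lerDl// exprn_ge0//; by case/andP: albe.
have : C * be ^+ n < e / 4 * B z.
  apply: (@lt_le_trans _ _ (e / 4 * al ^+ n)); last by rewrite ler_pM2l ?Bal.
  by move: qn; rewrite expr_div_n mulrA ltr_pdivrMr.
by have := mulr_gt0 e4 B0; lra.
Qed.

End approximation.

Theorem A0_dense K f : compact K -> K `<=` @torus2 R -> in_A0 f ->
  (forall z, K z -> 0 < complex.Re (f z)) ->
  forall g, {within K, continuous g} -> forall e : R, 0 < e ->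
    exists2 h, in_A0 h & forall z, K z -> cmod (h z - g z) < e.
Proof.
move=> cK KT [f' [Af' fE]] f0 g cg e e0.
have Kb := subset_trans KT torus2_closed_bidisc.
(* Membership in A_0 constrains f on the torus only. F agrees with f there and is an element of the
   bidisc algebra itself. *)
pose F z := z.1 * z.2 * f' z.
have AF : bidisc_algebra F.
  apply: bidisc_algebraM; last exact: Af'.
  by apply: bidisc_algebraM; [exact: bidisc_algebra_fst|exact: bidisc_algebra_snd].
have fF z : K z -> f z = F z by move=> /KT; exact: fE.
have cReF : {within K, continuous (fun z => complex.Re (F z))}.
  apply/within_continuous_realP => x Kx d d0.
  have /within_continuous_complexP/(_ x Kx d d0)[r r0 h] := bidisc_algebra_within Kb AF.
  exists r => // y Ky /(h y Ky); apply: le_lt_trans.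
  by rewrite -cReN -cReD Re_le_cmod.
have F0 z : K z -> 0 < complex.Re (F z) by move=> Kz; rewrite -fF// f0.
have [d d0 dF] := compact_pos_lower_bound cK cReF F0.
have clF : in_sup_closure K F by exact: sup_closure_alg.
have clFV := sup_closureV cK Kb clF d0 dF.
have Fneq0 z : K z -> F z != 0.
  by move=> /F0; apply: contraTneq => ->; rewrite ltxx.
have A1 : in_sup_closure K (fun z => z.1) by exact/sup_closure_alg/bidisc_algebra_fst.
have A2 : in_sup_closure K (fun z => z.2) by exact/sup_closure_alg/bidisc_algebra_snd.
have Af : in_sup_closure K f' by exact: sup_closure_alg.
have c1 : in_sup_closure K (fun z => conjc z.1).
  apply: (@sup_closure_ext _ _ (fun z => z.2 * f' z * (F z)^-1)).
    move=> z Kz; have [z1 _] := torus_cmod (KT z Kz).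
    apply: (mulIf (Fneq0 z Kz)); rewrite divfK ?Fneq0// /F.
    by rewrite -[LHS]mul1r -(mulC_unit z1); ring.
  by apply: sup_closureM => //; exact: sup_closureM.
have c2 : in_sup_closure K (fun z => conjc z.2).
  apply: (@sup_closure_ext _ _ (fun z => z.1 * f' z * (F z)^-1)).
    move=> z Kz; have [_ z2] := torus_cmod (KT z Kz).
    apply: (mulIf (Fneq0 z Kz)); rewrite divfK ?Fneq0// /F.
    by rewrite -[LHS]mul1r -(mulC_unit z2); ring.
  by apply: sup_closureM => //; exact: sup_closureM.
have clg := sup_closure_continuous cK KT c1 c2 cg.
have [M M0 FM] := sup_closure_bounded cK Kb clF.
have eM : 0 < e / (M + 1) by rewrite divr_gt0// ltr_wpDl.
have [a Aa ag] := sup_closureM cK Kb clg clFV eM.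
exists (fun z => a z * f z); first by apply: in_A0Ml => //; exists f'.
move=> z Kz; rewrite fF//.
have -> : a z * F z - g z = (a z - g z * (F z)^-1) * F z.
  by rewrite mulrBl divfK// Fneq0.
rewrite cmodM; apply: (@le_lt_trans _ _ (cmod (a z - g z * (F z)^-1) * (M + 1))).
  by rewrite ler_wpM2l ?cmod_ge0// (le_trans (FM z Kz))// lerDl.
by rewrite -ltr_pdivlMr ?ag// ltr_wpDl.
Qed.

End density.

(** * Positive functionals annihilating Re A_0 *)

Section duality.
Context {R : realType}.
Variable S : set (C2 R).

Definition bounded_on (u : C2 R -> R) := exists M : R, forall x, S x -> `|u x| <= M.

Lemma bounded_onD (u v : C2 R -> R) : bounded_on u -> bounded_on v -> bounded_on (u + v).
Proof.
move=> [M uM] [N vN]; exists (M + N) => x Sx.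
by apply: le_trans (ler_normD _ _) _; rewrite lerD ?uM ?vN.
Qed.

Lemma bounded_onZ (a : R) (u : C2 R -> R) : bounded_on u -> bounded_on (a *: u).
Proof.
move=> [M uM]; exists (`|a| * M) => x Sx.
by rewrite normrM ler_wpM2l ?uM.
Qed.

Lemma bounded_on_cst (c : R) : bounded_on (fun=> c).
Proof. by exists `|c| => x _. Qed.

(** [L] acts on functions merely bounded on S, so Hahn-Banach involves no continuity; this enters
    with the Riesz theorem. The normalisation at 1 records that [L] is nonzero. Annihilation carries
    a boundedness premise because S is an arbitrary set here. *)
Record annihilating_functional (L : (C2 R -> R) -> R) : Prop := {
  functionalD : forall u v, bounded_on u -> bounded_on v ->
    L (fun x => u x + v x) = L u + L v;
  functionalZ : forall a u, bounded_on u -> L (fun x => a * u x) = a * L u;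
  functional_ge0 : forall u, bounded_on u -> (forall x, S x -> 0 <= u x) -> 0 <= L u;
  functional_ge1 : 1 <= L (fun=> 1);
  functional_annihilates : forall h, in_A0 h ->
    bounded_on (fun x => complex.Re (h (Tflip x))) ->
    L (fun x => complex.Re (h (Tflip x))) = 0
}.

(* Hahn-Banach for p(u) = inf over A_0 of sup_S (u + Re h o T). *)
Lemma exists_annihilating_functional :
  (forall h : C2 R -> Cplx R, in_A0 h -> exists2 x, S x & 0 <= complex.Re (h (Tflip x))) ->
  exists L, annihilating_functional L.
Proof.
move=> hA.
pose P (u : C2 R -> R) : set R := [set c | exists2 h, in_A0 h &
  forall x, S x -> u x + complex.Re (h (Tflip x)) <= c].
pose p u := inf (P u).
(* The hypothesis is used here: every h has a point of S where Re h o T >= 0, so no choice of h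
   pushes the supremum below - M and p is finite. *)
have Plb u M : (forall x, S x -> `|u x| <= M) -> lbound (P u) (- M).
  move=> uM c [h Ah hc]; have [x Sx hx] := hA h Ah.
  apply: le_trans (hc x Sx); have := uM x Sx; rewrite ler_norml => /andP[+ _]; lra.
have ple u c h : bounded_on u -> in_A0 h ->
    (forall x, S x -> u x + complex.Re (h (Tflip x)) <= c) -> p u <= c.
  move=> [M uM] Ah hc; apply: ge_inf; last by exists h.
  by exists (- M); exact: Plb.
have p0 u c : bounded_on u -> (forall x, S x -> u x <= c) -> p u <= c.
  by move=> bu uc; apply: (ple _ _ (fun=> 0)) => //; [exact: in_A0_0|
    move=> x /uc; rewrite /= addr0].
have Pne u : bounded_on u -> P u !=set0.
  move=> [M uM]; exists M, (fun=> 0); first exact: in_A0_0.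
  by move=> x /uM; rewrite /= addr0; apply: le_trans; exact: ler_norm.
have sp : sublinear_on bounded_on p.
  split=> [u v bu bv|t u t0 bu].
    rewrite -lerBlDr; apply: lb_le_inf; first exact: Pne.
    move=> c [h Ah hc]; rewrite lerBlDr -lerBlDl.
    apply: lb_le_inf; first exact: Pne.
    move=> c' [h' Ah' hc']; rewrite lerBlDl.
    apply: (ple _ _ (fun z => h z + h' z)); [exact: bounded_onD|exact: in_A0D|].
    move=> x Sx; rewrite cReD; have := hc x Sx; have := hc' x Sx.
    rewrite -[(u + v) x]/(u x + v x); lra.
  rewrite -ler_pdivrMl//; apply: lb_le_inf; first exact: Pne.
  move=> c [h Ah hc]; rewrite ler_pdivrMl//.
  apply: (ple _ _ (fun z => real_complex R t * h z)).
  - exact: bounded_onZ.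
  - exact: in_A0Z.
  - move=> x Sx; rewrite cReM /= mul0r subr0.
    by have := hc x Sx; rewrite -(ler_pM2l t0) mulrDr.
have [L [LD LZ Lp]] := hahn_banach_sublinear_on (bounded_on_cst 0) bounded_onD bounded_onZ sp.
have LN u : bounded_on u -> L (- u) = - L u.
  by move=> bu; rewrite -scaleN1r LZ// mulN1r.
have bN u : bounded_on u -> bounded_on (- u).
  by move=> bu; rewrite -scaleN1r; exact: bounded_onZ.
exists L; split.
- exact: LD.
- exact: LZ.
- move=> u bu u0; rewrite -oppr_le0 -LN//; apply: le_trans (Lp _ (bN _ bu)) _.
  by apply: p0 => [|x Sx]; [exact: bN|rewrite /= oppr_le0 u0].
- have b1 := bounded_on_cst 1.
  have : L (- (fun=> 1)) <= -1.
    by apply: le_trans (Lp _ (bN _ b1)) _; apply: p0; [exact: bN|].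
  by rewrite LN// lerN2.
(* The competitor - h in the infimum cancels Re h o T, so p is at most 0 there. The same bound for -
   h turns the inequality into an equality. *)
- have le0 h : in_A0 h -> bounded_on (fun x => complex.Re (h (Tflip x))) ->
      L (fun x => complex.Re (h (Tflip x))) <= 0.
    move=> Ah bh; apply: le_trans (Lp _ bh) _.
    apply: (ple _ _ (fun z => - 1 * h z)) => //; first exact: in_A0Z.
    by move=> x Sx; rewrite mulN1r cReN subrr.
  move=> h Ah bh; apply/eqP; rewrite eq_le le0//=.
  rewrite -oppr_le0 -LN//.
  have -> : - (fun x => complex.Re (h (Tflip x))) =
      (fun x => complex.Re ((fun z => -1 * h z) (Tflip x))).
    by apply/funext => x; rewrite mulN1r cReN.
  apply: (le0 (fun z => -1 * h z)); first exact: in_A0Z.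
  by case: bh => M hM; exists M => x /hM; rewrite mulN1r cReN normrN.
Qed.

End duality.

(** * Cauchy transforms and Poisson integrals *)

Section quadratic_remainder.
Context {R : realType}.

Lemma cmod_prod_norm (h : C2 R) : real_complex R (cdist h 0) <= `|h| *+ 2.
Proof.
have -> : `|h| = Num.max `|h.1| `|h.2| by [].
rewrite /cdist.
have -> : h.1 - (0 : C2 R).1 = h.1 by exact: subr0.
have -> : h.2 - (0 : C2 R).2 = h.2 by exact: subr0.
rewrite rmorphD /=.
rewrite -(normr_cmodE h.1) -(normr_cmodE h.2) mulr2n.
have cmp : (`|h.1| : Cplx R) >=< `|h.2|.
  by rewrite !normr_cmodE /Order.comparable !lecR le_total.
by apply: lerD; rewrite (comparable_le_max _ cmp) lexx ?orbT.
Qed.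

(** With an explicit differential and an O(|h|^2) remainder, holomorphy of a transform under [L]
    needs only sup-norm estimates on the kernel and no differentiation under the functional. *)
Lemma differentiable_quadratic_remainder (f : C2 R -> Cplx R) (x : C2 R)
    (p q : Cplx R) (C r : R) : 0 < r ->
  (forall h : C2 R, cdist h 0 < r ->
    cmod (f (h + x) - f x - (h.1 * p + h.2 * q)) <= C * cdist h 0 ^+ 2) ->
  differentiable f x.
Proof.
move=> r0 fC.
pose df (h : C2 R) : Cplx R := h.1 * p + h.2 * q.
have df_lin : linear df.
  move=> a u v; rewrite /df /= /GRing.scale /=; ring.
pose dfM := GRing.isLinear.Build _ _ _ _ df df_lin.
pose dfL : {linear C2 R -> Cplx R} := HB.pack df dfM.
have cdf : continuous dfL.
  move=> y; apply: (@cvgD _ (Cplx R)).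
    by apply: cvgM; [exact: cvg_fst|exact: cvg_cst].
  by apply: cvgM; [exact: cvg_snd|exact: cvg_cst].
have fo : f \o shift x = cst (f x) + dfL +o_ (0 : C2 R) id.
  apply/eqaddoP => _ /gt0_real_complex[e e0 ->].
  have C1 : 0 < `|C| + 1 by rewrite ltr_wpDl.
  (* One factor [cdist h 0] of the remainder absorbs C; the 2 pays for comparing the l^1 distance
     with the sup norm of the product. *)
  apply/nbhs_cdistP; exists (Num.min r (e / 2 / (`|C| + 1))).
    by rewrite lt_min r0 !divr_gt0.
  move=> h; rewrite cdistC lt_min => /andP[hr he].
  have := fC h hr; rewrite -/(df h) => {}fC.
  rewrite [X in `|X|](_ : _ = f (h + x) - f x - df h); last first.
    by rewrite !fctE /= opprD addrA.
  rewrite normr_cmodE; apply: (@le_trans _ _ (real_complex R (e / 2 * cdist h 0))).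
    rewrite lecR; apply: le_trans fC _; rewrite expr2 mulrA.
    apply: ler_wpM2r; first exact: cdist_ge0.
    apply: (@le_trans _ _ ((`|C| + 1) * cdist h 0)).
      by apply: ler_wpM2r; [exact: cdist_ge0|have := ler_norm C; lra].
    by rewrite mulrC -ler_pdivlMr// ltW.
  rewrite rmorphM /=; apply: (@le_trans _ _ (real_complex R (e / 2) * (`|h| *+ 2))).
    by apply: ler_wpM2l; [rewrite ler0c ltW// divr_gt0|exact: cmod_prod_norm].
  have -> : real_complex R e = real_complex R (e / 2) *+ 2.
    by rewrite -rmorphMn /= -mulr_natr divfK.
  by rewrite mulrnAl mulrnAr.
have E : 'd f x = dfL :> (C2 R -> Cplx R) by exact: diff_unique cdf fo.
by apply/diff_locallyP; rewrite E.
Qed.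

End quadratic_remainder.

(** * Splitting the Poisson kernel of the bidisc by signs of frequencies *)

Section poisson_identity.
Context {R : realType}.
Implicit Types z w : Cplx R.

Lemma Re_inv w : complex.Re w^-1 = complex.Re w / cmod w ^+ 2.
Proof. by rewrite sqr_cmod; case: w. Qed.

(** With v = 1 - z conj w one has |w - z| = |v| and |z| = |1 - v|; then 1 - |1 - v|^2 = 2 Re v -
    |v|^2 is divided by |v|^2. *)
Lemma poisson_kernel1 z w : cmod w = 1 -> cmod z < 1 ->
  (1 - cmod z ^+ 2) / cmod (w - z) ^+ 2 = 2 * complex.Re (1 - z * conjc w)^-1 - 1.
Proof.
move=> w1 z1; set v := 1 - z * conjc w.
have vE : w - z = w * v.
  by rewrite /v mulrBr mulr1 mulrCA mulC_unit// mulr1.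
have v0 : v != 0 by rewrite one_sub_mul_neq0// cmod_conj w1.
have zE : cmod z ^+ 2 = cmod (1 - v) ^+ 2.
  by rewrite /v opprB addrCA subrr addr0 cmodM cmod_conj w1 mulr1.
have vn0 : cmod v != 0 by rewrite cmod_eq0.
have key : 1 - cmod (1 - v) ^+ 2 = 2 * complex.Re v - cmod v ^+ 2.
  by rewrite !sqr_cmod cReD cImD cReN cImN /=; ring.
by rewrite vE cmodM w1 mul1r Re_inv zE key; field.
Qed.

(** Put A = 1 + a and B = 1 + b, so the factors are 1 + a + conj a and 1 + b + conj b. Products of
    like type assemble into AB and its conjugate, with 1 counted twice; the two mixed ones are conj
    a b and its conjugate. *)
Lemma poisson_product (A B : Cplx R) :
  (2 * complex.Re A - 1) * (2 * complex.Re B - 1) =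
  2 * complex.Re (A * B) - 1 + 2 * complex.Re ((conjc A - 1) * (B - 1)).
Proof.
case: A => a a'; case: B => b b' /=; ring.
Qed.

Definition cauchy2 (z x : C2 R) : Cplx R :=
  (1 - z.1 * conjc x.1)^-1 * (1 - z.2 * conjc x.2)^-1.

(* Product of w / (1 - w) at w = conj z1 * y1 and at w = z2 * y2: composed with
   T, this carries the frequencies of opposite signs of the Poisson kernel. *)
Definition mixed (z y : C2 R) : Cplx R :=
  (conjc z.1 * z.2) *
  (y.1 * y.2 * ((1 - conjc z.1 * y.1)^-1 * (1 - z.2 * y.2)^-1)).

Lemma mixed_in_A0 (z : C2 R) : open_bidisc z -> in_A0 (mixed z).
Proof.
move=> []; rewrite !norm_lt1 => z1 z2.
apply: in_A0Z; exists (fun y => (1 - conjc z.1 * y.1)^-1 * (1 - z.2 * y.2)^-1).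
by split; [apply: bidisc_algebra_cauchy_kernel; rewrite ?cmod_conj|].
Qed.

(** The Cauchy term is holomorphic in z. The mixed term involves both conj z1 and z2 and would spoil
    pluriharmonicity, but as a function of x it is of the form killed by an annihilating
    functional. *)
Lemma poisson_kernelE (z x : C2 R) : open_bidisc z -> torus2 x ->
  poisson_kernel z x =
  2 * complex.Re (cauchy2 z x) - 1 + 2 * complex.Re (mixed z (Tflip x)).
Proof.
move=> []; rewrite !norm_lt1 => z1 z2 /torus_cmod[x1 x2].
rewrite /poisson_kernel !poisson_kernel1// poisson_product.
congr (_ + 2 * complex.Re _); rewrite /mixed /Tflip /=.
have inv_sub1 (v : Cplx R) : 1 - v != 0 -> (1 - v)^-1 - 1 = v * (1 - v)^-1.
  by move=> v0; field.
have -> : conjc (1 - z.1 * conjc x.1)^-1 = (1 - conjc z.1 * x.1)^-1.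
  by rewrite conjc_inv rmorphB rmorphM rmorph1 /= conjcK.
rewrite !inv_sub1 ?one_sub_mul_neq0 ?cmod_conj ?x1 ?x2//.
ring.
Qed.

Lemma poisson_kernel_ge0 (z x : C2 R) : open_bidisc z -> 0 <= poisson_kernel z x.
Proof.
move=> []; rewrite !norm_lt1 => z1 z2; rewrite /poisson_kernel.
have h (w : Cplx R) : cmod w < 1 -> 0 <= 1 - cmod w ^+ 2.
  by move=> w1; rewrite subr_ge0 expr_le1 ?cmod_ge0// ltW.
by rewrite mulr_ge0// divr_ge0 ?h// sqr_ge0.
Qed.

Lemma poisson_kernel_continuous (z : C2 R) : open_bidisc z ->
  {within @torus2 R, continuous (poisson_kernel z)}.
Proof.
move=> []; rewrite !norm_lt1 => z1 z2.
have c1 : {within @torus2 R, continuous (fun x : C2 R => cmod (x.1 - z.1))}.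
  apply: within_continuous_cmod; apply: (bidisc_algebra_within torus2_closed_bidisc).
  by apply: bidisc_algebraD; [exact: bidisc_algebra_fst|exact: bidisc_algebra_cst].
have c2 : {within @torus2 R, continuous (fun x : C2 R => cmod (x.2 - z.2))}.
  apply: within_continuous_cmod; apply: (bidisc_algebra_within torus2_closed_bidisc).
  by apply: bidisc_algebraD; [exact: bidisc_algebra_snd|exact: bidisc_algebra_cst].
move/subspace_continuousP: c1 => c1; move/subspace_continuousP: c2 => c2.
apply/subspace_continuousP => x Tx; have [x1 x2] := torus_cmod Tx.
have ne (w y : Cplx R) : cmod w < 1 -> cmod y = 1 -> cmod (y - w) ^+ 2 != 0.
  move=> w1 y1; rewrite expf_neq0// cmod_eq0 subr_eq0.
  by apply: contraTneq w1 => <-; rewrite y1 ltxx.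
apply: cvgM; (apply: cvgM; first exact: cvg_cst); apply: cvgV; rewrite ?ne//.
  by apply: cvgM; exact: c1.
by apply: cvgM; exact: c2.
Qed.

End poisson_identity.

(** * Complex extension of the functional and holomorphy of its Cauchy transform *)

Section complex_functional.
Context {R : realType}.
Variables (S : set (C2 R)) (L : (C2 R -> R) -> R).
Hypothesis hL : annihilating_functional S L.
Hypothesis ST : S `<=` @torus2 R.
Implicit Types (u v : C2 R -> R) (k l : C2 R -> Cplx R).

Local Notation L1 := (L (fun=> 1)).

Lemma functional_le u v : bounded_on S u -> bounded_on S v ->
  (forall x, S x -> u x <= v x) -> L u <= L v.
Proof.
move=> bu bv uv; have bN : bounded_on S (fun x => -1 * u x) := bounded_onZ (-1) bu.
have := functional_ge0 hL (bounded_onD bv bN); rewrite (functionalD hL bv bN).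
rewrite (functionalZ hL _ bu) mulN1r subr_ge0; apply => x Sx.
by have := uv x Sx; rewrite -subr_ge0 -[- u x]mulN1r.
Qed.

(** Positivity, applied to both differences, makes [L] depend only on restrictions to [S]. *)
Lemma functional_ext u v : bounded_on S u ->
  (forall x, S x -> u x = v x) -> L u = L v.
Proof.
move=> bu uv; have bv : bounded_on S v.
  by case: bu => M uM; exists M => x Sx; rewrite -uv// uM.
by apply/eqP; rewrite eq_le !functional_le// => x /uv ->.
Qed.

Lemma functional_norm_le u (M : R) : (forall x, S x -> `|u x| <= M) ->
  `|L u| <= M * L1.
Proof.
move=> uM; have bu : bounded_on S u by exists M.
have bM (c : R) : bounded_on S (fun=> c) by exact: bounded_on_cst.
have LM (c : R) : L (fun=> c) = c * L1.
  by rewrite -(functionalZ hL c (bM 1)); congr L; apply/funext => x; rewrite mulr1.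
rewrite ler_norml -mulNr -!LM; apply/andP; split; apply: functional_le => // x /uM;
  by rewrite ler_norml => /andP[].
Qed.

Definition cfunctional k : Cplx R :=
  Complex (L (fun x => complex.Re (k x))) (L (fun x => complex.Im (k x))).

Definition cbounded k := exists M : R, forall x, S x -> cmod (k x) <= M.

Lemma cbounded_Re k : cbounded k -> bounded_on S (fun x => complex.Re (k x)).
Proof.
by move=> [M kM]; exists M => x /kM; apply: le_trans; exact: Re_le_cmod.
Qed.

Lemma cbounded_Im k : cbounded k -> bounded_on S (fun x => complex.Im (k x)).
Proof.
by move=> [M kM]; exists M => x /kM; apply: le_trans; exact: Im_le_cmod.
Qed.

Lemma cboundedD k l : cbounded k -> cbounded l -> cbounded (fun x => k x + l x).
Proof.
move=> [M kM] [N lN]; exists (M + N) => x Sx.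
by apply: le_trans (cmodD _ _) _; rewrite lerD ?kM ?lN.
Qed.

Lemma cboundedZ (c : Cplx R) k : cbounded k -> cbounded (fun x => c * k x).
Proof.
move=> [M kM]; exists (cmod c * M) => x Sx.
by rewrite cmodM ler_wpM2l ?cmod_ge0 ?kM.
Qed.

Lemma cfunctionalD k l : cbounded k -> cbounded l ->
  cfunctional (fun x => k x + l x) = cfunctional k + cfunctional l.
Proof.
move=> bk bl; rewrite /cfunctional.
have -> : (fun x => complex.Re (k x + l x)) = (fun x => complex.Re (k x) + complex.Re (l x)).
  by apply/funext => x; exact: cReD.
have -> : (fun x => complex.Im (k x + l x)) = (fun x => complex.Im (k x) + complex.Im (l x)).
  by apply/funext => x; exact: cImD.
by rewrite !(functionalD hL)//; do ?[exact: cbounded_Re|exact: cbounded_Im].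
Qed.

Lemma cfunctionalZ (c : Cplx R) k : cbounded k ->
  cfunctional (fun x => c * k x) = c * cfunctional k.
Proof.
move=> bk; rewrite /cfunctional.
have bR := cbounded_Re bk; have bI := cbounded_Im bk.
have b (a : R) u : bounded_on S u -> bounded_on S (fun x => a * u x) := @bounded_onZ _ _ a u.
have -> : (fun x => complex.Re (c * k x)) =
  (fun x => complex.Re c * complex.Re (k x) + - complex.Im c * complex.Im (k x)).
  by apply/funext => x; rewrite cReM mulNr.
have -> : (fun x => complex.Im (c * k x)) =
  (fun x => complex.Re c * complex.Im (k x) + complex.Im c * complex.Re (k x)).
  by apply/funext => x; rewrite cImM.
rewrite !(functionalD hL)//; do ?exact: b.
rewrite !(functionalZ hL)//.
by case: c => c c' /=; apply/eqP; rewrite eq_complex /=; apply/andP; split;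
  apply/eqP; ring.
Qed.

Lemma cfunctional_ext k l : cbounded k -> (forall x, S x -> k x = l x) ->
  cfunctional k = cfunctional l.
Proof.
move=> bk kl; rewrite /cfunctional; congr Complex; apply: functional_ext;
  do ?[exact: cbounded_Re|exact: cbounded_Im]; by move=> x /kl ->.
Qed.

Lemma cfunctional_le k (M : R) : (forall x, S x -> cmod (k x) <= M) ->
  cmod (cfunctional k) <= 2 * M * L1.
Proof.
move=> kM; apply: le_trans (cmod_le_ReIm _) _ => /=.
rewrite -mulrA mulr_natl mulr2n; apply: lerD; apply: functional_norm_le => x /kM;
  apply: le_trans; [exact: Re_le_cmod|exact: Im_le_cmod].
Qed.

Lemma cauchy_factor_le (a c : Cplx R) (r : R) : 0 < r -> cmod a <= 1 - r ->
  cmod c = 1 -> cmod (1 - a * c)^-1 <= r^-1 /\ 1 - a * c != 0.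
Proof.
move=> r0 ar c1; have h : r <= cmod (1 - a * c).
  have := cmodD (1 - a * c) (a * c); rewrite subrK cmod1 cmodM c1 mulr1; lra.
have h0 := lt_le_trans r0 h.
by split; [rewrite cmodV lef_pV2|rewrite -cmod_gt0].
Qed.

(** The resolvent identity A' = A + h c A A' is used in each factor and once more in the terms of
    first order, which leaves exactly three quadratic terms. *)
Lemma cauchy_remainder (h k a b c e : Cplx R) :
  1 - a * c != 0 -> 1 - (h + a) * c != 0 -> 1 - b * e != 0 -> 1 - (k + b) * e != 0 ->
  let A := (1 - a * c)^-1 in let A' := (1 - (h + a) * c)^-1 in
  let B := (1 - b * e)^-1 in let B' := (1 - (k + b) * e)^-1 in
  A' * B' = A * B + (h * (c * (A * A * B)) + (k * (e * (A * B * B)) +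
   (h * k * (c * e * (A * A' * B * B')) + (h * h * (c * c * (A * A * A' * B)) +
    k * k * (e * e * (A * B * B * B')))))).
Proof. by move=> h1 h2 h3 h4 /=; field; rewrite h1 h2 h3 h4. Qed.

Definition cauchy_transform (z : C2 R) : Cplx R := cfunctional (cauchy2 z).

Lemma cauchy2_bounded z : open_bidisc z -> cbounded (cauchy2 z).
Proof.
move=> []; rewrite !norm_lt1 => z1 z2.
exists ((1 - cmod z.1)^-1 * (1 - cmod z.2)^-1) => x /ST/torus_cmod[x1 x2].
have d1 : 0 < 1 - cmod z.1 by rewrite subr_gt0.
have d2 : 0 < 1 - cmod z.2 by rewrite subr_gt0.
have sub (a : R) : a <= 1 - (1 - a) by lra.
have [h1 _] := @cauchy_factor_le z.1 (conjc x.1) _ d1 (sub _) (etrans (cmod_conj _) x1).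
have [h2 _] := @cauchy_factor_le z.2 (conjc x.2) _ d2 (sub _) (etrans (cmod_conj _) x2).
by rewrite cmodM ler_pM ?cmod_ge0.
Qed.

Lemma cauchy_transform_differentiable z : open_bidisc z ->
  differentiable cauchy_transform z.
Proof.
move=> zb; have [] := zb; rewrite !norm_lt1 => z1 z2.
(* Half the gap to the boundary: rho + r = 1 - r, so for increments of size at most r every Cauchy
   factor, at z or at h + z, is bounded by 1 / r. *)
pose rho := Num.max (cmod z.1) (cmod z.2); pose r := (1 - rho) / 2.
have rho1 : rho < 1 by rewrite gt_max z1 z2.
have r0 : 0 < r by rewrite divr_gt0// subr_gt0.
have zr1 : cmod z.1 <= rho by rewrite le_max lexx.
have zr2 : cmod z.2 <= rho by rewrite le_max lexx orbT.
pose M := r^-1; have M0 : 0 <= M by rewrite invr_ge0 ltW.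
pose A x := (1 - z.1 * conjc (x : C2 R).1)^-1.
pose B x := (1 - z.2 * conjc (x : C2 R).2)^-1.
pose dA x := conjc (x : C2 R).1 * (A x * A x * B x).
pose dB x := conjc (x : C2 R).2 * (A x * B x * B x).
have fact (a w : Cplx R) : cmod a <= rho + r -> cmod w = 1 ->
    cmod (1 - a * conjc w)^-1 <= M /\ 1 - a * conjc w != 0.
  move=> ar w1; apply: cauchy_factor_le => //; last by rewrite cmod_conj.
  by apply: le_trans ar _; rewrite /r; lra.
have zr : rho <= rho + r by rewrite lerDl ltW.
have cM3 (a b c : Cplx R) : cmod a <= M -> cmod b <= M -> cmod c <= M ->
    cmod (a * b * c) <= M ^+ 3.
  by move=> aM bM dM; rewrite !cmodM !exprS expr0 mulr1 mulrA !ler_pM ?mulr_ge0 ?cmod_ge0.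
have cM4 (a b c d : Cplx R) : cmod a <= M -> cmod b <= M -> cmod c <= M ->
    cmod d <= M -> cmod (a * b * c * d) <= M ^+ 4.
  move=> aM bM dM eM; rewrite (cmodM _ d) exprSr ler_pM ?cmod_ge0//.
  exact: cM3.
have AM x : S x -> cmod (A x) <= M.
  by move=> /ST/torus_cmod[x1 x2]; apply: (fact _ _ _ x1).1; exact: le_trans zr1 zr.
have BM x : S x -> cmod (B x) <= M.
  by move=> /ST/torus_cmod[x1 x2]; apply: (fact _ _ _ x2).1; exact: le_trans zr2 zr.
have bdA : cbounded dA.
  exists (M ^+ 3) => x Sx; have [x1 x2] := torus_cmod (ST Sx).
  rewrite /dA cmodM cmod_conj x1 mul1r.
  by apply: cM3; [exact: AM|exact: AM|exact: BM].
have bdB : cbounded dB.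
  exists (M ^+ 3) => x Sx; have [x1 x2] := torus_cmod (ST Sx).
  rewrite /dB cmodM cmod_conj x2 mul1r.
  by apply: cM3; [exact: AM|exact: BM|exact: BM].
(* [dA] and [dB] are the partial derivatives of the kernel in z1 and z2. The remainder has three
   terms, each with four Cauchy factors, whence 3 M^4; the factor 2 L 1 comes from
   [cfunctional_le]. *)
apply: (@differentiable_quadratic_remainder R _ z (cfunctional dA) (cfunctional dB)
   (2 * (M ^+ 4 *+ 3) * L1) r r0) => h hr.
set t := cdist h 0 in hr *.
have h1t : cmod h.1 <= t by rewrite /t /cdist !subr0 lerDl cmod_ge0.
have h2t : cmod h.2 <= t by rewrite /t /cdist !subr0 lerDr cmod_ge0.
pose A' x := (1 - (h.1 + z.1) * conjc (x : C2 R).1)^-1.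
pose B' x := (1 - (h.2 + z.2) * conjc (x : C2 R).2)^-1.
have hz1 : cmod (h.1 + z.1) <= rho + r.
  by apply: le_trans (cmodD _ _) _; rewrite addrC lerD// (le_trans h1t)// ltW.
have hz2 : cmod (h.2 + z.2) <= rho + r.
  by apply: le_trans (cmodD _ _) _; rewrite addrC lerD// (le_trans h2t)// ltW.
have AM' x : S x -> cmod (A' x) <= M.
  by move=> /ST/torus_cmod[x1 x2]; apply: (fact _ _ _ x1).1.
have BM' x : S x -> cmod (B' x) <= M.
  by move=> /ST/torus_cmod[x1 x2]; apply: (fact _ _ _ x2).1.
pose E x := h.1 * h.2 * (conjc x.1 * conjc x.2 * (A x * A' x * B x * B' x)) +
  (h.1 * h.1 * (conjc x.1 * conjc x.1 * (A x * A x * A' x * B x)) +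
   h.2 * h.2 * (conjc x.2 * conjc x.2 * (A x * B x * B x * B' x))).
have EM x : S x -> cmod (E x) <= M ^+ 4 *+ 3 * t ^+ 2.
  move=> Sx; have [x1 x2] := torus_cmod (ST Sx).
  have term (a b c d w : Cplx R) : cmod a <= t -> cmod b <= t -> cmod c = 1 ->
      cmod d = 1 -> cmod w <= M ^+ 4 -> cmod (a * b * (conjc c * conjc d * w)) <= M ^+ 4 * t ^+ 2.
    move=> at_ bt c1 d1 wM; rewrite !cmodM !cmod_conj c1 d1 !mul1r mulrC expr2.
    by rewrite ler_pM ?cmod_ge0 ?mulr_ge0 ?cmod_ge0// ler_pM ?cmod_ge0.
  rewrite mulrnAl !mulrS mulr0n addr0.
  apply: le_trans (cmodD _ _) _; apply: lerD.
    apply: (term _ _ _ _ _ h1t h2t x1 x2).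
    by apply: cM4; [exact: AM|exact: AM'|exact: BM|exact: BM'].
  apply: le_trans (cmodD _ _) _; apply: lerD.
    apply: (term _ _ _ _ _ h1t h1t x1 x1).
    by apply: cM4; [exact: AM|exact: AM|exact: AM'|exact: BM].
  apply: (term _ _ _ _ _ h2t h2t x2 x2).
    by apply: cM4; [exact: AM|exact: BM|exact: BM|exact: BM'].
have bE : cbounded E by exists (M ^+ 4 *+ 3 * t ^+ 2).
have bz := cauchy2_bounded zb.
have b1 : cbounded (fun x => h.1 * dA x) := cboundedZ h.1 bdA.
have b2 : cbounded (fun x => h.2 * dB x) := cboundedZ h.2 bdB.
have b3 := cboundedD b2 bE.
have b4 := cboundedD b1 b3.
have -> : cauchy_transform (h + z) = cauchy_transform z +
    (h.1 * cfunctional dA + (h.2 * cfunctional dB + cfunctional E)).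
  rewrite -(cfunctionalZ h.1 bdA) -(cfunctionalZ h.2 bdB) -(cfunctionalD b2 bE).
  rewrite -(cfunctionalD b1 b3) -(cfunctionalD bz b4).
  apply/esym/cfunctional_ext; first exact: cboundedD bz b4.
  move=> x Sx; have [x1 x2] := torus_cmod (ST Sx).
  exact/esym/(cauchy_remainder (fact _ _ (le_trans zr1 zr) x1).2
    (fact _ _ hz1 x1).2 (fact _ _ (le_trans zr2 zr) x2).2 (fact _ _ hz2 x2).2).
have -> (a b c d : Cplx R) : a + (b + (c + d)) - a - (b + c) = d by ring.
apply: le_trans (cfunctional_le EM) _.
by rewrite le_eqVlt; apply/orP; left; apply/eqP; ring.
Qed.

End complex_functional.

(** * The RP-measure *)

Section representing_measure.
Context {R : realType}.

Lemma C2_compact_closed (S : set (C2 R)) : compact S -> closed S.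
Proof. by move=> cS; apply: (compact_closed _ cS); exact: (@norm_hausdorff _ (C2 R)). Qed.

Lemma torus2_closed : closed (@torus2 R).
Proof.
rewrite -openC openE => x /= Tx; apply/nbhs_cdistP.
have [x1|x1] := eqVneq (cmod x.1) 1; last first.
  exists `|cmod x.1 - 1|; first by rewrite normr_gt0 subr_eq0.
  move=> y xy [/norm_eq1 y1 _]; move: xy; rewrite ltNge => /negP; apply.
  rewrite /cdist ler_norml -y1; have := cmod_ge0 (x.2 - y.2).
  have := cmodD (x.1 - y.1) y.1; have := cmodD (y.1 - x.1) x.1.
  rewrite !subrK (cmodC y.1); lra.
have [x2|x2] := eqVneq (cmod x.2) 1.
  by exfalso; apply: Tx; split; apply/norm_eq1.
exists `|cmod x.2 - 1|; first by rewrite normr_gt0 subr_eq0.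
move=> y xy [_ /norm_eq1 y2]; move: xy; rewrite ltNge => /negP; apply.
rewrite /cdist ler_norml -y2; have := cmod_ge0 (x.1 - y.1).
have := cmodD (x.2 - y.2) y.2; have := cmodD (y.2 - x.2) x.2.
rewrite !subrK (cmodC y.2); lra.
Qed.

Lemma Tflip_torus (x : C2 R) : torus2 x -> torus2 (Tflip x).
Proof.
move=> /torus_cmod[x1 x2]; split; apply/norm_eq1 => //=.
by rewrite cmod_conj.
Qed.

Lemma cdist_Tflip (x y : C2 R) : cdist (Tflip x) (Tflip y) = cdist x y.
Proof.
rewrite /cdist /Tflip /=.
have -> : conjc x.2 - conjc y.2 = conjc (x.2 - y.2) by rewrite rmorphB.
by rewrite cmod_conj.
Qed.

Lemma compact_Tflip (S : set (C2 R)) : compact S -> compact (@Tflip R @` S).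
Proof.
move=> cS; apply: continuous_compact => //; apply: continuous_subspaceT => x.
move=> A /nbhs_cdistP[e e0 eA]; apply/nbhs_cdistP; exists e => // y xy.
by apply: eA; rewrite cdist_Tflip.
Qed.

Lemma within_bounded_on (S : set (C2 R)) (u : C2 R -> R) : compact S ->
  {within S, continuous u} -> bounded_on S u.
Proof.
move=> cS cu; have cnu : {within S, continuous (fun x => `|u x|)}.
  by move=> x; apply: cvg_norm; exact: cu.
by have [M _ uM] := compact_upper_bound cS cnu; exists M.
Qed.

Variables (S : set (C2 R)) (L : (C2 R -> R) -> R).
Hypotheses (cS : compact S) (ST : S `<=` @torus2 R).
Hypothesis hL : annihilating_functional S L.

Lemma functional_poisson (z : C2 R) : open_bidisc z ->
  L (poisson_kernel z) =
  complex.Re (2 * cauchy_transform L z - real_complex R (L (fun=> 1))).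
Proof.
move=> zb; have bK := cbounded_Re (cauchy2_bounded ST zb).
have bP : bounded_on S (poisson_kernel z).
  apply: within_bounded_on => //.
  exact: continuous_subspaceW ST (poisson_kernel_continuous zb).
have b1 : bounded_on S (fun=> 1 : R) := bounded_on_cst S 1.
have bZ (a : R) (u : C2 R -> R) : bounded_on S u -> bounded_on S (fun x => a * u x).
  exact: bounded_onZ.
have bK2 := bZ 2 _ bK; have bN1 := bZ (-1) _ b1.
have bK1 : bounded_on S (fun x => 2 * complex.Re (cauchy2 z x) + -1 * 1).
  exact: bounded_onD.
have bm : bounded_on S (fun x => complex.Re (mixed z (Tflip x))).
  have [f [Af mf]] := mixed_in_A0 zb.
  pose g y := y.1 * y.2 * f y.
  have Ag : bidisc_algebra g.
    apply: bidisc_algebraM; last exact: Af.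
    by apply: bidisc_algebraM; [exact: bidisc_algebra_fst|exact: bidisc_algebra_snd].
  have TSb : (@Tflip R @` S) `<=` @closed_bidisc R.
    by move=> _ [x /ST/Tflip_torus Tx <-]; exact: torus2_closed_bidisc.
  have [M _ gM] := bidisc_algebra_bounded (compact_Tflip cS) TSb Ag.
  exists M => x Sx; rewrite mf; last exact/Tflip_torus/ST.
  by apply: le_trans (Re_le_cmod _) _; apply: gM; exists x.
have bm2 := bZ 2 _ bm.
rewrite (functional_ext hL (v := fun x => (2 * complex.Re (cauchy2 z x) + -1 * 1) +
    2 * complex.Re (mixed z (Tflip x))) bP); last first.
  by move=> x /ST Tx; rewrite poisson_kernelE// mulN1r.
rewrite (functionalD hL bK1 bm2) (functionalD hL bK2 bN1).
rewrite (functionalZ hL _ bK) (functionalZ hL _ bm) (functionalZ hL _ b1).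
(* Annihilation removes the mixed term, the only one that is not the real part of a function
   holomorphic in z. *)
rewrite (functional_annihilates hL (mixed_in_A0 zb) bm) mulr0 addr0 mulN1r.
have -> : (2 : Cplx R) = real_complex R 2 by rewrite rmorph_nat.
by rewrite cReD cReN cReM /= mul0r subr0.
Qed.

Lemma exists_positive_RP_measure :
  exists mu : {measure set (C2B R) -> \bar R},
    [/\ positive_RP_measure mu, support_within mu S & mu setT != 0%E].
Proof.
have clS := C2_compact_closed cS.
have bw u : {within S, continuous u} -> bounded_on S u by exact: within_bounded_on.
have [||||mu [muT muS mui]] :=
    @riesz_markov_representation R (C2_ptopological R) S L cS clS.
- exact: open_cozero.
- by move=> u v /bw bu /bw bv; exact: (functionalD hL).
- by move=> a u /bw bu; exact: (functionalZ hL).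
- by move=> u /bw bu; exact: (functional_ge0 hL).
have mT : measurable (@torus2 R : set (C2B R)).
  exact: (@closed_borel (C2_ptopological R) _ torus2_closed).
have mS : measurable (S : set (C2B R)).
  exact: (@closed_borel (C2_ptopological R) _ clS).
exists (mu : {measure set (C2B R) -> \bar R}); split; last 2 first.
- move=> x Sx; exists (~` S); split => //.
  by rewrite openC.
- by rewrite muT eqe gt_eqF// (lt_le_trans ltr01)// (functional_ge1 hL).
split; first by rewrite muT ltry.
  apply: (subset_measure0 _ _ _ muS); [exact: measurableC|exact: measurableC|].
  by apply: subsetC.
exists (fun z => 2 * cauchy_transform L z - real_complex R (L (fun=> 1))); split.
  move=> z zb; apply: differentiableB; last exact: differentiable_cst.
  apply: (@differentiableM _ _ (cst 2)); first exact: differentiable_cst.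
  exact: (cauchy_transform_differentiable hL ST zb).
move=> z zb; rewrite -functional_poisson// /poisson_integral.
have cP := poisson_kernel_continuous zb.
have cPS : {within S, continuous (poisson_kernel z)} := continuous_subspaceW ST cP.
have [M _ PM] := compact_upper_bound cS cPS.
rewrite -(mui _ M cPS); last first.
  by move=> x Sx; rewrite poisson_kernel_ge0//= PM.
have mC : measurable (~` S : set (C2B R)) by exact: measurableC.
have mP : measurable_fun (@torus2 R : set (C2B R)) (fun x : C2B R => (poisson_kernel z x)%:E).
  apply/measurable_EFinP.
  exact: (@within_continuous_borel R (C2_ptopological R) _ _ torus2_closed cP).
(* The Poisson integral runs over the torus and the Riesz formula over [S]; the difference is a null
   set. *)
rewrite (ge0_negligible_integral mC mT mP _ muS); last first.
  by move=> x _; rewrite lee_fin poisson_kernel_ge0.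
by rewrite setDE setCK setIidr.
Qed.

End representing_measure.

(** * The dichotomy and the conclusion *)

Unset Implicit Arguments.

Theorem mainTheorem14 (R : realType) (S : set (C2 R)) :
  compact S -> S `<=` @torus2 R ->
  (forall mu : {measure set (C2B R) -> \bar R},
      positive_RP_measure mu -> support_within mu S -> mu setT = 0%E) ->
  forall g : C2 R -> Cplx R, {within (@Tflip R) @` S, continuous g} ->
  forall eps : R, 0 < eps ->
    exists h : C2 R -> Cplx R, in_A0 h /\
      forall z, ((@Tflip R) @` S) z -> @cmod R (h z - g z) < eps.
Proof.
move=> cS ST noRP g cg eps eps0.
have [[f Af f0]|noA] := pselect (exists2 f : C2 R -> Cplx R, in_A0 f &
    forall z, (@Tflip R @` S) z -> 0 < complex.Re (f z)).
  have TS : (@Tflip R @` S) `<=` @torus2 R.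
    by move=> _ [x /ST/Tflip_torus Tx <-].
  have [h Ah hg] := A0_dense (compact_Tflip cS) TS Af f0 cg eps0.
  by exists h.
have [h Ah|L hL] := @exists_annihilating_functional R S.
  (* If Re h o T were negative on all of S, then - h would have positive real part on T(S), which is
     the case already excluded. *)
  apply: contrapT => hS; apply: noA; exists (fun z => - 1 * h z); first exact: in_A0Z.
  move=> _ [x Sx <-]; rewrite mulN1r cReN oppr_gt0 ltNge; apply/negP => hx.
  by apply: hS; exists x.
have [mu [RP supp /eqP]] := exists_positive_RP_measure cS ST hL.
by rewrite noRP.
Qed.
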